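(* Let $n\ge 1$, $\sigma,\tau\in S_n$, and let $X=X(\sigma,\tau)$ be the associated square-tiled surface. Let $A\in SL_2^+(\mathbb{Z})$ and let $I$ be the $2\times 2$ identity matrix. Then $A\in Veech^+(X)$ if and only if $\mathsf{Code}^L(A)$ is conjugate to $\mathsf{Code}^L(I)$.
   Context: Permutations are multiplied left to right: $\alpha\beta$ means apply $\alpha$ first, then $\beta$. Square-tiled surface: for $\sigma,\tau\in S_n$, $X(\sigma,\tau)$ is obtained from $n$ unit squares $Q_1,\dots,Q_n$ (sides parallel to the axes) by gluing, via translations, the right side of $Q_i$ to the left side of $Q_{\sigma(i)}$ and the top side of $Q_i$ to the bottom side of $Q_{\tau(i)}$. It need not be connected. The images of corners of squares are the marked points. The map of $X$ to the unit square torus pulls back $dz$ to a holomorphic 1-form on $X$; its zeros are marked points (those of total angle $>2\pi$), and away from them $X$ has a translation structure. Rational numbers and saddle connections: a ''rational number'' $\frac pq$ means that $(q,p)$ is a coprime pair of positive integers or $(q,p)\in\{(1,0),(0,1)\}$ (so $0=\frac01$ and $\infty=\frac10$ are allowed). For $r=\frac pq$ and $i\in\{1,\dots,n\}$, $\gamma_i$ is the straight segment on $X$ with displacement $(q,p)$ starting at the south-west corner of $Q_i$: if $r\notin\{0,\infty\}$ it begins inside $Q_i$; if $r=0$ it is the bottom side of $Q_i$; if $r=\infty$ it is the left side of $Q_i$. The complement of $\gamma_1\cup\dots\cup\gamma_n$ is a disjoint union of open Euclidean cylinders. $\gamma_i$ is a left boundary of the cylinder $C$ if $C$ lies on the left-hand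 side when walking along $\gamma_i$ in direction $(q,p)$. Left code: $\mathsf{Code}^L(r)=\mathsf{Code}^L_X(r)\in S_n$ is defined by $\mathsf{Code}^L(r)(i)=k$ if, $C$ being the cylinder having $\gamma_i$ as a left boundary, the next left boundary of $C$ met after $\gamma_i$ when walking in direction $(q,p)$ along the boundary of $C$ is $\gamma_k$. (With these conventions $\mathsf{Code}^L(0)=\sigma$ and $\mathsf{Code}^L(\infty)=\sigma^{-1}\tau\sigma$.) Matrices: $SL_2^+(\mathbb{Z})$ is the set of matrices in $SL_2(\mathbb{Z})$ with all entries nonnegative. For $A=\begin{bmatrix} a&c\\ b&d\end{bmatrix}\in SL_2^+(\mathbb{Z})$, $\mathsf{Code}^L(A):=\left(\mathsf{Code}^L\left(\frac ba\right),\mathsf{Code}^L\left(\frac dc\right)\right)\in S_n\times S_n$. Pairs $(\omega_1,\omega_2)$ and $(\omega_1',\omega_2')$ are conjugate if there is a single $\omega\in S_n$ with $\omega_j'=\omega\omega_j\omega^{-1}$ for $j=1,2$. Veech group: an affine diffeomorphism of $X$ is an orientation-preserving homeomorphism $f$ of $X$ that preserves the set of zeros of the 1-form, is a diffeomorphism off that set, and there has constant derivative (in the translation structure) equal to a matrix of $SL_2(\mathbb{Z})$. $Veech(X)$ is the group of derivatives of affine diffeomorphisms of $X$, and $Veech^+(X)=Veech(X)\cap SL_2^+(\mathbb{Z})$. *)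

(* Defs.v *)
From HB Require Import structures.
From Stdlib Require Import Relation_Operators.
From mathcomp Require Import all_boot all_order all_fingroup all_algebra.
From mathcomp Require Import all_classical all_reals all_analysis.

Set Implicit Arguments.
Unset Strict Implicit.
Unset Printing Implicit Defensive.

Import Order.TTheory GRing.Theory Num.Theory.
Import numFieldNormedType.Exports.

Local Open Scope classical_set_scope.
Local Open Scope ring_scope.
Local Open Scope quotient_scope.

(* Vectors and points of the plane are columns: row 0 is the horizontal
   coordinate, row 1 the vertical one, and matrices act on the left. *)

Definition vec (T : Type) (x y : T) : 'cV[T]_2 :=
  \col_k (if k == 0 then x else y).

Definition unit_square (R : realType) : set 'cV[R]_2 :=
  [set u | forall k, 0 <= u k 0 <= 1].
Arguments unit_square R : clear implicits.

Lemma unit_square_corner (R : realType) (x y : bool) :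
  vec (x%:R : R) y%:R \in unit_square R.
Proof.
by apply/mem_set => k; rewrite mxE; case: ifP => _; rewrite ler0n lern1 leq_b1.
Qed.

(* The disjoint union of the closed squares Q_i, with its sum topology. *)
Definition squares (R : realType) (n : nat) : topologicalType :=
  {i : 'I_n & set_type (unit_square R)}.

Definition sq_pt (R : realType) (n : nat) (i : 'I_n)
  (u : set_type (unit_square R)) : squares R n :=
  existT (fun=> set_type (unit_square R)) i u.

Section Surface.
Context (R : realType) (n : nat) (sigma tau : 'S_n).

Inductive glue : squares R n -> squares R n -> Prop :=
| glue_right_left (i : 'I_n) (u v : set_type (unit_square R)) :
    set_val u 0 0 = 1 -> set_val v 0 0 = 0 -> set_val u 1 0 = set_val v 1 0 ->
    glue (sq_pt i u) (sq_pt (sigma i) v)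
| glue_top_bottom (i : 'I_n) (u v : set_type (unit_square R)) :
    set_val u 1 0 = 1 -> set_val v 1 0 = 0 -> set_val u 0 0 = set_val v 0 0 ->
    glue (sq_pt i u) (sq_pt (tau i) v).

Definition glued : rel (squares R n) :=
  fun x y => `[< clos_refl_sym_trans _ glue x y >].

Lemma glued_refl : reflexive glued.
Proof. by move=> x; apply/asboolP; exact: rst_refl. Qed.

Lemma glued_sym : symmetric glued.
Proof.
by move=> x y; apply/asboolP/asboolP => h; exact: rst_sym.
Qed.

Lemma glued_trans : transitive glued.
Proof.
by move=> y x z /asboolP xy /asboolP yz; apply/asboolP; exact: rst_trans yz.
Qed.

Canonical glued_equiv := EquivRel glued glued_refl glued_sym glued_trans.

Definition surface : topologicalType :=
  quotient_topology {eq_quot glued_equiv}.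

Definition pt (i : 'I_n) (u : set_type (unit_square R)) : surface :=
  \pi_{eq_quot glued_equiv} (sq_pt i u).

(* [over x v] : the image of x under the map from the surface to the unit
   square torus R^2 / Z^2 is the class of v. *)
Definition over (x : surface) (v : 'cV[R]_2) : Prop :=
  exists (i : 'I_n) (u : set_type (unit_square R)) (m : 'cV[int]_2),
    x = pt i u /\ v = set_val u + map_mx intr m.

Definition corner (c : 'I_n * bool * bool) : surface :=
  pt c.1.1 (SigSub (unit_square_corner R c.1.2 c.2)).

(* Total angle at a marked point: each corner of a square glued to it
   contributes pi / 2.  (At an unmarked point this is 0.) *)
Definition corner_angle (x : surface) : R :=
  (pi / 2) *+ #|[set c | corner c == x]%SET|.

Definition zeros : set surface := [set x | 2 * pi < corner_angle x].

(* The pulled back form is dz, so its local primitives are the local lifts to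
   R^2 of the map to the torus, up to additive constants, which do not affect
   derivatives and are normalized here. *)
Definition translation_chart (U : set surface) (phi : surface -> 'cV[R]_2) :=
  [/\ open U, U `<=` ~` zeros,
      {within U, continuous phi} /\ {in U &, injective phi},
      (forall V, open V -> V `<=` U -> open (phi @` V)) &
      (forall x, U x -> over x (phi x))].

(* In translation charts phi at x and psi at f x, the map f is read as G. *)
Definition has_derivative (f : surface -> surface) (x : surface)
    (B : 'M[R]_2) : Prop :=
  exists (U V : set surface) (phi psi : surface -> 'cV[R]_2)
         (G : 'cV[R]_2 -> 'cV[R]_2),
    [/\ translation_chart U phi /\ U x, translation_chart V psi /\ V (f x),
        (\forall y \near x, psi (f y) = G (phi y)) &
        is_diff (phi x) G (fun v => B *m v)].

(* Since \det A = 1 > 0, f preserves the orientation off the finite set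
   [zeros].  Both f and its inverse have constant derivative there, hence are
   smooth there. *)
Definition affine_diffeo (f : surface -> surface) (A : 'M[int]_2) : Prop :=
  \det A = 1 /\
  exists g : surface -> surface,
    [/\ cancel f g /\ cancel g f, continuous f /\ continuous g,
        f @` zeros = zeros,
        (forall x, ~ zeros x -> has_derivative f x (map_mx intr A)) &
        (forall x, ~ zeros x -> has_derivative g x (map_mx intr (invmx A)))].

Definition Veech : set 'M[int]_2 := [set A | exists f, affine_diffeo f A].

(* Below, p and q stand for the rational number p / q, that is, for the
   direction (q, p). *)

Definition direction (p q : int) : 'cV[R]_2 := vec q%:~R p%:~R.

(* g restricted to [0, 1] is the segment gamma_i: a lift of t |-> t (q, p),
   given in the square Q_i as long as t (q, p) stays in the unit square.  For
   p / q = 0 (resp. infinity) this is the whole bottom (resp. left) side. *)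
Definition is_gamma (p q : int) (i : 'I_n) (g : R -> surface) : Prop :=
  [/\ {within `[0, 1], continuous g},
      (forall t, 0 <= t <= 1 -> over (g t) (t *: direction p q)) &
      (forall t (u : set_type (unit_square R)), 0 <= t <= 1 ->
         set_val u = t *: direction p q -> g t = pt i u)].

Definition gammas (p q : int) : set surface :=
  [set x | exists i g, is_gamma p q i g /\ (g @` `[0, 1]) x].

Definition cylinder (p q : int) (C : set surface) : Prop :=
  exists2 x, (~` gammas p q) x & C = connected_component (~` gammas p q) x.

(* Walking in direction (q, p) along the boundary of C, with C on the left,
   one traverses gamma_j for j in the list js, successively.  The first
   coordinate of z measures the progress along the boundary; the second one
   measures the displacement to the left, in direction (- p, q).  The collar F
   is contained in C except for its edge z.2 = 0, which is the boundary path. *)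
Definition left_walk (p q : int) (C : set surface) (js : seq 'I_n) : Prop :=
  exists (e : R) (F : R * R -> surface),
    let D := [set z : R * R | 0 <= z.1 <= (size js)%:R /\ 0 <= z.2 < e] in
    [/\ 0 < e, {within D, continuous F},
        (forall z, D z -> over (F z)
           (z.1 *: direction p q + z.2 *: direction q (- p))),
        (forall z, D z -> 0 < z.2 -> C (F z)) &
        (forall m j, onth js m = Some j ->
           is_gamma p q j (fun t => F (m%:R + t, 0)))].

Definition left_boundary (p q : int) (C : set surface) (i : 'I_n) : Prop :=
  left_walk p q C [:: i].

Definition next_left (p q : int) (i k : 'I_n) : Prop :=
  exists C, [/\ cylinder p q C, left_boundary p q C i &
                left_walk p q C [:: i; k]].

(* The permutation is unique and exists when p / q is a rational number in the
   extended sense; the default value 1 is then irrelevant. *)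
Definition codeL (p q : int) : 'S_n :=
  xget 1%g [set s : 'S_n | forall i, next_left p q i (s i)].

Definition codeL_mx (A : 'M[int]_2) : 'S_n * 'S_n :=
  (codeL (A 1 0) (A 0 0), codeL (A 1 1) (A 0 1)).

End Surface.

Definition SL2plus : set 'M[int]_2 :=
  [set A | \det A = 1 /\ forall i j, 0 <= A i j].

Definition Veech_plus (R : realType) (n : nat) (sigma tau : 'S_n) :
  set 'M[int]_2 := Veech R sigma tau `&` SL2plus.

(* The product of permutations is left to right: (s * t) x = t (s x). *)
Definition conjugate_pairs (n : nat) (P P' : 'S_n * 'S_n) : Prop :=
  exists w : 'S_n, (P'.1 = w * P.1 * w^-1 /\ P'.2 = w * P.2 * w^-1)%g.

(* Main.v *)
(* A matrix A in SL2+ is a product of elementary shears, and cutting and pasting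
   squares turns each shear into an affine homeomorphism between square-tiled
   surfaces. So there are permutations s', t' and an affine homeomorphism h of
   derivative A from X(s', t') to X = X(sigma, tau), which maps the square Q'_i to
   the parallelogram spanned by the columns of A at the south-west corner of Q_i.
   Pulling the left walks in the direction of either column of A back to the
   horizontal and vertical directions of X(s', t') gives
   CodeL(A) = (s', s'^-1 t' s'), while CodeL(I) = (sigma, sigma^-1 tau sigma).
   Hence the codes are conjugate if and only if (s', t') and (sigma, tau) are.
   If they are, relabelling the squares and applying h is an affine
   diffeomorphism of derivative A. Conversely, an affine diffeomorphism f of
   derivative A makes f^-1 h a map X(s', t') -> X which is locally a translation;
   it need not preserve the marked points, but it maps the centre of Q'_j to a
   point of exactly one half-open square Q_(w j). Following unit horizontal and
   vertical segments between centres shows that w conjugates the two pairs. *)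

From Stdlib Require Import Relation_Operators.
Require Import Defs.
From mathcomp Require Import all_boot all_order all_fingroup all_algebra.
From mathcomp Require Import all_classical all_reals all_analysis.
From mathcomp Require Import ring lra zify.

Set Implicit Arguments.
Unset Strict Implicit.
Unset Printing Implicit Defensive.

Import Order.TTheory GRing.Theory Num.Theory.
Import numFieldNormedType.Exports.

Local Open Scope classical_set_scope.
Local Open Scope ring_scope.
Local Open Scope quotient_scope.

(** * Points of the surface and stars of points *)

(** Over the torus, lifts of a path are unique only away from the zeros, where several squares share
    a corner. Points of a surface are therefore compared along paths that avoid zeros: open edges,
    arches passing above the end points of edges, segments between centres. The second obstacle is
    that an affine diffeomorphism is known only through its derivatives in charts, off the zeros;
    [transport] integrates them along a path and returns a statement on torus coordinates alone. The
    opposite passage, from coordinates to derivatives, rests on the fact that a continuous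
    discrepancy with values in a coset of the integers is locally constant. The code of the second
    column of A is reduced to that of a first column by a quarter turn, and this turn is what
    conjugates [t'] by [s']. That [w] is injective is not formal: two centres could go to different
    points of one half-open square. A straight segment joins these points there; the diffeomorphism
    makes its displacement integral, hence zero. *)

Section Points.
Context (R : realType) (n : nat) (sigma tau : 'S_n).
Local Notation X := (surface R sigma tau).

(** Clamping lets arbitrary reals address points of a square, so that [ptc] is total and continuous
    and carries no membership proof in its arguments. *)
Definition clamp (x : R) : R := Num.max 0 (Num.min 1 x).

Lemma clamp_id (x : R) : 0 <= x <= 1 -> clamp x = x.
Proof. by case/andP=> x0 x1; rewrite /clamp min_r// max_r. Qed.

Lemma clamp0 : clamp 0 = 0.
Proof. by rewrite clamp_id// lexx ler01. Qed.

Lemma clamp1 : clamp 1 = 1.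
Proof. by rewrite clamp_id// lexx ler01. Qed.

Lemma clamp_itv (x : R) : 0 <= clamp x <= 1.
Proof.
by rewrite /clamp le_max lexx/= ge_max ler01/= ge_min lexx.
Qed.

Lemma clamp_continuous : continuous clamp.
Proof.
move=> x; rewrite /clamp; apply: (@continuous_max R R (fun=> 0) (fun y => Num.min 1 y)); first exact: cst_continuous.
by apply: (@continuous_min R R (fun=> 1) id); [exact: cst_continuous|exact: cvg_id].
Qed.

Lemma clamp_square (x y : R) : vec (clamp x) (clamp y) \in unit_square R.
Proof. by apply/mem_set => k; rewrite mxE; case: ifP => _; exact: clamp_itv. Qed.

Definition sqc (x y : R) : set_type (unit_square R) :=
  SigSub (clamp_square x y).

Lemma sqc0 (x y : R) : set_val (sqc x y) 0 0 = clamp x.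
Proof. exact: mxE. Qed.

Lemma sqc1 (x y : R) : set_val (sqc x y) 1 0 = clamp y.
Proof. exact: mxE. Qed.

Definition ptc (i : 'I_n) (x y : R) : X :=
  pt sigma tau i (sqc x y).

Lemma vec0 (T : Type) (x y : T) : vec x y 0 0 = x.
Proof. by rewrite mxE. Qed.

Lemma vec1 (T : Type) (x y : T) : vec x y 1 0 = y.
Proof. by rewrite mxE. Qed.

Lemma vecE (T : Type) (v : 'cV[T]_2) : v = vec (v 0 0) (v 1 0).
Proof.
apply/matrixP => k j; rewrite !mxE (ord1 j).
by case: k => -[|[|//]] ? /=; congr (v _ _); apply/val_inj.
Qed.

Lemma unit_squareE (u : set_type (unit_square R)) :
  (0 <= set_val u 0 0 <= 1) /\ (0 <= set_val u 1 0 <= 1).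
Proof. by have /set_mem h := valP u; split; exact: h. Qed.

Lemma pt_ptc i u : pt sigma tau i u = ptc i (set_val u 0 0) (set_val u 1 0).
Proof.
rewrite /ptc; congr pt; apply/val_inj => /=.
have [h0 h1] := unit_squareE u.
by rewrite !clamp_id// -vecE.
Qed.

Lemma surfaceP (x : X) :
  exists i s t, [/\ 0 <= s <= 1, 0 <= t <= 1 & x = ptc i s t].
Proof.
have : x = \pi_{eq_quot (glued_equiv R sigma tau)} (generic_quotient.repr x).
  by rewrite [RHS](@reprK _ (surface R sigma tau)).
case: (generic_quotient.repr x) => i u xE.
have [h0 h1] := unit_squareE u.
exists i, (set_val u 0 0), (set_val u 1 0); split=> //.
by rewrite -pt_ptc.
Qed.

Lemma pt_glue (a b : squares R n) : Defs.glue sigma tau a b ->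
  \pi_{eq_quot (glued_equiv R sigma tau)} a = \pi_{eq_quot (glued_equiv R sigma tau)} b.
Proof. by move=> ab; apply/eqmodP/asboolP; exact: rst_step. Qed.

Lemma ptc_right i y : ptc i 1 y = ptc (sigma i) 0 y.
Proof.
apply: pt_glue; apply: glue_right_left;
  by rewrite ?sqc0 ?sqc1 ?clamp0 ?clamp1.
Qed.

Lemma ptc_top i x : ptc i x 1 = ptc (tau i) x 0.
Proof.
apply: pt_glue; apply: glue_top_bottom;
  by rewrite ?sqc0 ?sqc1 ?clamp0 ?clamp1.
Qed.

End Points.

Arguments ptc {R n} sigma tau i x y.

Lemma cvg_matrix (T : topologicalType) m n (F : set_system 'M[T]_(m, n)) (M : 'M[T]_(m, n)) :
  Filter F -> (forall i j, (fun N : 'M[T]_(m, n) => N i j) @ F --> M i j) -> F --> M.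
Proof.
move=> FF h A [P MP sPA]; apply: (filterS sPA).
apply: filter_forall => i; apply: filter_forall => j.
exact: (h i j _ (MP i j)).
Qed.

(** * Descent to the quotient, torus coordinates, zeros and stars *)

Section Gluing.
Context (R : realType) (n : nat) (sigma tau : 'S_n).
Local Notation X := (surface R sigma tau).

Lemma cvg_vec (T : Type) (F : set_system T) (f g : T -> R) (x y : R) :
  Filter F -> f @ F --> x -> g @ F --> y ->
  (fun t => vec (f t) (g t)) @ F --> vec x y.
Proof.
move=> FF fx gy; apply: cvg_matrix => i j.
rewrite (_ : _ @ _ = (fun t => if i == 0 then f t else g t) @ F); last first.
  rewrite -fmap_comp; congr (_ @ F); apply/funext => t /=.
  by rewrite mxE.
by rewrite mxE; case: ifP.
Qed.

Lemma ptc_cvg (T : Type) (F : set_system T) (f g : T -> R) (x y : R) i :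
  Filter F -> f @ F --> x -> g @ F --> y ->
  (fun t => ptc sigma tau i (f t) (g t)) @ F --> ptc sigma tau i x y.
Proof.
move=> FF fx gy.
pose u (a b : R) := sqc a b.
have uc : (fun t => u (f t) (g t)) @ F --> u x y.
  move=> A [_ [[B Bop <-] Bxy sBA]]; apply: (filterS sBA).
  have : (fun t => vec (clamp (f t)) (clamp (g t))) @ F --> vec (clamp x) (clamp y).
    apply: cvg_vec.
      by apply: cvg_comp fx _; exact: clamp_continuous.
    by apply: cvg_comp gy _; exact: clamp_continuous.
  by apply; exact: open_nbhs_nbhs.
have sc : (fun t => sq_pt i (u (f t) (g t))) @ F --> sq_pt i (u x y).
  by apply: (cvg_comp _ _ uc); exact: existT_continuous.
apply: (cvg_comp _ _ sc).
exact: (@pi_continuous (squares R n) {eq_quot (glued_equiv R sigma tau)}).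
Qed.

(** The elimination principle of the quotient: [p] is constant along generating gluings, hence on
    the equivalence they generate. Choosing [P] with values in pairs of reals, optional labels or
    propositions gives invariants that tell points apart. *)
Lemma ptc_descent (Z : Type) (P : 'I_n -> R -> R -> Z) :
  (forall i y, 0 <= y <= 1 -> P i 1 y = P (sigma i) 0 y) ->
  (forall i x, 0 <= x <= 1 -> P i x 1 = P (tau i) x 0) ->
  exists Q : X -> Z, forall i x y, 0 <= x <= 1 -> 0 <= y <= 1 ->
    Q (ptc sigma tau i x y) = P i x y.
Proof.
move=> Pr Pt.
pose p (a : squares R n) := P (tag a) (set_val (tagged a) 0 0) (set_val (tagged a) 1 0).
have pg a b : Defs.glue sigma tau a b -> p a = p b.
  case=> i u v; rewrite /p /= => -> -> h; have [h0 h1] := unit_squareE u.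
    by rewrite -h Pr.
  by rewrite -h Pt.
have pc a b : clos_refl_sym_trans _ (Defs.glue sigma tau) a b -> p a = p b.
  by elim=> // c e f _ -> _ ->.
exists (fun x => p (generic_quotient.repr x)) => i x y hx hy.
rewrite (_ : P i x y = p (sq_pt i (sqc x y))); last first.
  by rewrite /p /= sqc0 sqc1 !clamp_id.
apply: pc; apply/asboolP.
have /eqmodP := @reprK _ (surface R sigma tau) (ptc sigma tau i x y).
by [].
Qed.


Definition ov (x : X) (a b : R) : Prop := Defs.over x (vec a b).

Lemma overE (x : X) (v : 'cV[R]_2) : Defs.over x v = ov x (v 0 0) (v 1 0).
Proof. by rewrite /ov -vecE. Qed.

Lemma ovP (x : X) (a b : R) : ov x a b <->
  exists i s t, [/\ 0 <= s <= 1, 0 <= t <= 1, x = ptc sigma tau i s t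
    & a - s \is a Num.int /\ b - t \is a Num.int].
Proof.
split=> [[i [u [m [-> e]]]]|[i [s [t [hs ht -> []]]]]].
  have [h0 h1] := unit_squareE u.
  exists i, (set_val u 0 0), (set_val u 1 0); split=> //; first exact: pt_ptc.
  have := congr1 (fun w : 'cV[R]_2 => w 0 0) e.
  have := congr1 (fun w : 'cV[R]_2 => w 1 0) e.
  rewrite vec0 vec1 !mxE => -> ->.
  by split; rewrite addrAC subrr add0r intr_int.
case/intrP=> m1 e1 /intrP[m2 e2].
exists i, (sqc s t), (vec m1 m2); split=> //.
rewrite [RHS]vecE !mxE /= -e1 -e2.
by rewrite !clamp_id// ![_ + (_ - _)]addrC !subrK.
Qed.

Lemma ov_ptc i (s t : R) : 0 <= s <= 1 -> 0 <= t <= 1 -> ov (ptc sigma tau i s t) s t.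
Proof. by move=> hs ht; apply/ovP; exists i, s, t; rewrite !subrr !rpred0. Qed.

Lemma ov_shift (x : X) (a b a' b' : R) : ov x a b ->
  a' - a \is a Num.int -> b' - b \is a Num.int -> ov x a' b'.
Proof.
move=> /ovP[i [s [t [hs ht -> [ha hb]]]]] h1 h2.
apply/ovP; exists i, s, t; split=> //; split.
  by rewrite -(subrK a a') -addrA rpredD.
by rewrite -(subrK b b') -addrA rpredD.
Qed.

(** Fractional parts are invariant under gluing, since 0 and 1 both have fractional part 0. *)
Lemma ov_uniq (x : X) (a b a' b' : R) : ov x a b -> ov x a' b' ->
  a - a' \is a Num.int /\ b - b' \is a Num.int.
Proof.
pose P (i : 'I_n) (s t : R) := (s - (Num.floor s)%:~R, t - (Num.floor t)%:~R).
have [||Q QE] := @ptc_descent (R * R) P.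
- by move=> i y _; rewrite /P !floor1 !floor0 subrr subr0.
- by move=> i y _; rewrite /P !floor1 !floor0 subrr subr0.
move=> /ovP[i [s [t [hs ht -> [ha hb]]]]] /ovP[j [s' [t' [hs' ht' e [ha' hb']]]]].
have := congr1 Q e; rewrite !QE// => -[e1 e2].
have fl (u u' : R) : u - (Num.floor u)%:~R = u' - (Num.floor u')%:~R ->
    u - u' \is a Num.int.
  move=> uu; rewrite (_ : u - u' = (Num.floor u)%:~R - (Num.floor u')%:~R).
    by rewrite rpredB ?intr_int.
  by lra.
split.
  rewrite (_ : a - a' = (a - s) + (s - s') - (a' - s')); last lra.
  by rewrite rpredB// rpredD// fl.
rewrite (_ : b - b' = (b - t) + (t - t') - (b' - t')); last lra.
by rewrite rpredB// rpredD// fl.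
Qed.

Lemma ov_ex (x : X) : exists a b, ov x a b.
Proof.
have [i [s [t [hs ht ->]]]] := surfaceP x.
by exists s, t; exact: ov_ptc.
Qed.

Lemma int_eq (a b : R) : a - b \is a Num.int -> `|a - b| < 1 -> a = b.
Proof.
move=> h; rewrite ltNge => h1; apply/eqP; rewrite -subr_eq0.
by apply: contraNT h1; exact: norm_intr_ge1.
Qed.

Lemma int_itv (s : R) : 0 <= s <= 1 -> s \is a Num.int -> exists b : bool, s = b%:R.
Proof.
move=> /andP[s0 s1] si; have [->|sN0] := eqVneq s 0; first by exists false.
exists true; apply/eqP; rewrite eq_le s1/= mulr1n.
by have := norm_intr_ge1 si sN0; rewrite ger0_norm.
Qed.

(** The invariant is the label obtained after moving right sides and top sides to the left or bottom
    side of the next square. Corners all get [None], because the moves by [sigma] and by [tau]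
    compete there. *)
Lemma ptc_inj i j (s t : R) : 0 <= s <= 1 -> 0 <= t <= 1 ->
  ~ (s \is a Num.int /\ t \is a Num.int) ->
  ptc sigma tau i s t = ptc sigma tau j s t -> i = j.
Proof.
move=> hs ht nc.
pose P (i : 'I_n) (s t : R) :=
  if (s \is a Num.int) && (t \is a Num.int) then None else
  Some (if s == 1 then sigma i else if t == 1 then tau i else i).
have i0 := @int_num0 R; have i1 := @int_num1 R.
have n0 : (0 == 1 :> R) = false by rewrite eq_sym oner_eq0.
have [||Q QE] := @ptc_descent (option 'I_n) P.
- move=> {}i y _; rewrite /P i0 i1/=; case: ifP => // yn.
  by rewrite eqxx n0; case: eqP => // y1; rewrite y1 i1 in yn.
- move=> {}i x _; rewrite /P i0 i1/= !andbT; case: ifP => // xn.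
  by rewrite eqxx n0; case: eqP => // y1; rewrite y1 i1 in xn.
move=> /(congr1 Q); rewrite !QE// /P.
case: ifP => [/andP//|_] [].
by case: ifP => _; [move/perm_inj|case: ifP => _ // /perm_inj].
Qed.

(* The corner (b1, b2) of Q_i is glued to the south-west corner of Q_(toSW b1 b2 i). *)
Definition toSW (b1 b2 : bool) : 'S_n :=
  ((if b1 then sigma else 1) * (if b2 then tau else 1))%g.

Lemma ptc_toSW i (b1 b2 : bool) :
  ptc sigma tau i (b1%:R : R) b2%:R = ptc sigma tau (toSW b1 b2 i) 0 0.
Proof.
by rewrite /toSW permM; case: b1; case: b2; rewrite ?perm1 /= ?ptc_right ?ptc_top.
Qed.

Lemma corner_ptc (c : 'I_n * bool * bool) :
  corner R sigma tau c = ptc sigma tau (toSW c.1.2 c.2 c.1.1) 0 0.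
Proof.
by rewrite -ptc_toSW /corner pt_ptc /= vec0 vec1.
Qed.

(** For each of the four kinds of corner, [toSW] is a permutation of the squares, so every marked
    point has as many corners of one kind as of another. *)
Lemma card_corner (x : X) :
  #|[set c | corner R sigma tau c == x]%SET| =
  (4 * #|[set i | ptc sigma tau i 0 0 == x]%SET|)%N.
Proof.
pose f (c : 'I_n * bool * bool) := (toSW c.1.2 c.2 c.1.1, c.1.2, c.2).
have fI : injective f.
  by move=> [[i b] b'] [[j c] c'] [] /[swap] -> /[swap] -> /perm_inj ->.
rewrite (_ : [set c | _]%SET = f @^-1: finset.setX (finset.setX [set i | ptc sigma tau i 0 0 == x]%SET [set: bool]%SET) [set: bool]%SET).
  rewrite on_card_preimset ?cardsX ?cardsT ?card_bool; first by rewrite -mulnA mulnC.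
  by apply: onW_bij; exact: injF_bij.
by apply/setP => c; rewrite !inE corner_ptc !andbT.
Qed.

(** By [card_corner] the angle is [2 * pi] times the number of south-west corners at [x], so it
    exceeds [2 * pi] exactly when there are two of them. *)
Lemma zerosP (x : X) : zeros x <->
  exists i j, [/\ i != j, ptc sigma tau i 0 0 = x & ptc sigma tau j 0 0 = x].
Proof.
rewrite /zeros /= /corner_angle card_corner.
rewrite (_ : pi / 2 *+ _ = (2 * pi) *+ #|[set i | ptc sigma tau i 0 0 == x]%SET|); last first.
  by rewrite mulrnA; congr (_ *+ _); rewrite -mulr_natr; field.
rewrite -[X in X < _]mulr1n ltr_pMn2l; last by rewrite mulr_gt0 ?pi_gt0.
split=> [/card_gt1P[i [j []]]|[i [j [ij ie je]]]].
  by rewrite !inE => /eqP ie /eqP je ij; exists i, j.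
by apply/card_gt1P; exists i, j; rewrite !inE ie je eqxx.
Qed.

(** Off the corners this is [ptc_inj]; at a corner, two labels would yield two south-west corners
    through [toSW], hence a zero. *)
Lemma regular_inj (x : X) i j (s t : R) : ~ zeros x -> 0 <= s <= 1 -> 0 <= t <= 1 ->
  ptc sigma tau i s t = x -> ptc sigma tau j s t = x -> i = j.
Proof.
move=> xr hs ht ie je.
have [[si ti]|nc] := pselect (s \is a Num.int /\ t \is a Num.int); last first.
  by apply: (ptc_inj hs ht nc); rewrite ie je.
have [b1 s1] := int_itv hs si; have [b2 t2] := int_itv ht ti.
apply/eqP; apply: contra_notT xr => ij; apply/zerosP.
exists (toSW b1 b2 i), (toSW b1 b2 j).
by rewrite -!ptc_toSW -s1 -t2 (inj_eq perm_inj).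
Qed.

Lemma ov_regular (x : X) (a b : R) : ov x a b ->
  ~ (a \is a Num.int /\ b \is a Num.int) -> ~ zeros x.
Proof.
move=> xo nab /zerosP[i [_ [_ xE _]]]; apply: nab.
have := @ov_ptc i 0 0; rewrite xE lexx ler01 => /(_ erefl erefl) /(ov_uniq xo).
by rewrite !subr0.
Qed.


(* At a zero x, the displacement (d1, d2) does not determine y. *)
Definition disp (e : R) (x y : X) (d1 d2 : R) : Prop :=
  exists i s t, [/\ 0 <= s <= 1 /\ 0 <= t <= 1,
    0 <= s + d1 <= 1 /\ 0 <= t + d2 <= 1,
    x = ptc sigma tau i s t /\ y = ptc sigma tau i (s + d1) (t + d2),
    `|d1| < e & `|d2| < e].

Lemma ov_disp e (x y : X) (a b d1 d2 : R) :
  ov x a b -> disp e x y d1 d2 -> ov y (a + d1) (b + d2).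
Proof.
move=> xo [i [s [t [[hs ht] [hs' ht'] [xE yE] _ _]]]].
have := ov_ptc i hs ht; rewrite -xE => /(ov_uniq xo)[h1 h2].
rewrite yE; apply: (ov_shift (ov_ptc i hs' ht')).
  by rewrite (_ : _ - _ = a - s)//; lra.
by rewrite (_ : _ - _ = b - t)//; lra.
Qed.


(* Below this scale, a union of small squares around the representatives of a
   point over a is saturated for the gluing. *)
Definition gap (e a : R) := [/\ 0 < e, e <= 2^-1 &
  forall m, m \is a Num.int -> a != m -> e <= `|a - m|].

Lemma gap_exists (a : R) : exists e, gap e a.
Proof.
have [ai|aN] := boolP (a \is a Num.int).
  exists 2^-1; split; [lra|lra|] => m mi am.
  have : 1 <= `|a - m| by apply: norm_intr_ge1; rewrite ?rpredB// subr_eq0.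
  by move=> h; apply: le_trans h; lra.
pose f : R := (Num.floor a)%:~R.
have fa : f < a.
  rewrite lt_neqAle floor_le andbT; apply: contraNneq aN => <-.
  exact: intr_int.
have af : a < f + 1 by have := floorD1_gt a; rewrite intrD1.
exists (Num.min 2^-1 (Num.min (a - f) (f + 1 - a))); split.
- by rewrite !lt_min !subr_gt0 fa af andbT invr_gt0 ltr0n.
- by rewrite ge_min lexx.
move=> _ /intrP[m ->] _; rewrite !ge_min; apply/orP; right; apply/orP.
have [mf|fm] := leP m (Num.floor a).
  left; have : m%:~R <= f by rewrite ler_int.
  by move=> h; rewrite ger0_norm; lra.
right; have : f + 1 <= m%:~R.
  by move: fm; rewrite -lezD1 -(ler_int R) intrD1.
by move=> h; rewrite ler0_norm; lra.
Qed.

Lemma gapS (e e' a : R) : 0 < e' -> e' <= e -> gap e a -> gap e' a.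
Proof.
move=> e0 ee [_ h1 h2]; split=> //; first exact: le_trans h1.
by move=> m mi /(h2 _ mi); exact: le_trans.
Qed.

(** Below the gap, a representative close to the line of a side must lie on it, and can then be
    moved across that side. *)
Lemma gap_eq (e a s m : R) : gap e a -> a - s \is a Num.int -> m \is a Num.int ->
  `|m - s| < e -> s = m.
Proof.
move=> [_ _ h] asi mi sm; apply/eqP; apply: contraTT sm => sm.
rewrite -leNgt distrC (_ : s - m = a - (a - s + m)); last by lra.
apply: h; first exact: rpredD.
by apply: contra sm => /eqP am; apply/eqP; lra.
Qed.

Definition star (e : R) (x : X) : set X := [set y | exists d1 d2, disp e x y d1 d2].

(** Membership in a star can be tested inside a single square. The test is compatible with gluing
    because, by [gap_eq], a representative near a glued side lies on it and has a twin in the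
    neighbouring square. *)
Lemma star_descent (x : X) (e a b : R) : ov x a b -> gap e a -> gap e b ->
  exists Q : X -> Prop, (forall y, star e x y <-> Q y) /\
  forall i s t, 0 <= s <= 1 -> 0 <= t <= 1 -> Q (ptc sigma tau i s t) =
    exists s' t', [/\ 0 <= s' <= 1, 0 <= t' <= 1, x = ptc sigma tau i s' t',
      `|s - s'| < e & `|t - t'| < e].
Proof.
move=> xo ga gb.
pose P (i : 'I_n) (s t : R) := exists s' t', [/\ 0 <= s' <= 1, 0 <= t' <= 1,
  x = ptc sigma tau i s' t', `|s - s'| < e & `|t - t'| < e].
have xint i s t : 0 <= s <= 1 -> 0 <= t <= 1 -> x = ptc sigma tau i s t ->
    a - s \is a Num.int /\ b - t \is a Num.int.
  by move=> hs ht xE; apply: (ov_uniq xo); rewrite xE; exact: ov_ptc.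
have i0 := @int_num0 R; have i1 := @int_num1 R.
have z01 : (0 : R) <= (0 : R) <= (1 : R) by lra.
have o01 : (0 : R) <= (1 : R) <= (1 : R) by lra.
have [||Q QE] := @ptc_descent Prop P.
- move=> i y _; apply/propext; split=> -[s [t [hs ht xE se te]]];
    have [ha hb] := xint _ _ _ hs ht xE; have s1 := gap_eq ga ha _ se.
    exists 0, t; split=> //; rewrite ?subrr ?normr0; last by case: ga.
    by rewrite -ptc_right -s1.
  exists 1, t; split=> //; rewrite ?subrr ?normr0; last by case: ga.
  by rewrite ptc_right -s1.
- move=> i y _; apply/propext; split=> -[s [t [hs ht xE se te]]];
    have [ha hb] := xint _ _ _ hs ht xE; have s1 := gap_eq gb hb _ te.
    exists s, 0; split=> //; rewrite ?subrr ?normr0; last by case: ga.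
    by rewrite -ptc_top -s1.
  exists s, 1; split=> //; rewrite ?subrr ?normr0; last by case: ga.
  by rewrite ptc_top -s1.
exists Q; split=> // y; split.
  move=> [d1 [d2 [i [s [t [[hs ht] [hs' ht'] [xE ->] d1e d2e]]]]]].
  rewrite QE//; exists s, t; split=> //.
    by rewrite addrAC subrr add0r.
  by rewrite addrAC subrr add0r.
have [i [s [t [hs ht ->]]]] := surfaceP y.
rewrite QE// => -[s' [t' [hs' ht' xE se te]]].
by exists (s - s'), (t - t'), i, s', t'; rewrite ![_ + (_ - _)]addrC !subrK.
Qed.

(** Openness in the quotient is checked square by square: by [star_descent] the trace of the star is
    a union of open boxes around the representatives of [x]. *)
Lemma star_nbhs (x : X) (e a b : R) : ov x a b -> gap e a -> gap e b ->
  nbhs x (star e x).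
Proof.
move=> xo ga gb.
have [Q [SQ QE]] := star_descent xo ga gb.
have e0 : 0 < e by case: ga.
apply: open_nbhs_nbhs; split; last first.
  have [i [s [t [hs ht xE]]]] := surfaceP x.
  by exists 0, 0, i, s, t; rewrite !addr0 !normr0.
suff : open (\pi_{eq_quot (glued_equiv R sigma tau)} @^-1` star e x) by [].
apply/sigT_openP => i.
pose B : set 'cV[R]_2 := \bigcup_(p in [set p : R * R | [/\ 0 <= p.1 <= 1, 0 <= p.2 <= 1 &
  x = ptc sigma tau i p.1 p.2]]) [set v | `|v 0 0 - p.1| < e /\ `|v 1 0 - p.2| < e].
exists B.
  apply: bigcup_open => p _.
  have op k (c : R) : open [set v : 'cV[R]_2 | `|v k 0 - c| < e].
    rewrite (_ : [set _ | _] = (fun v : 'cV[R]_2 => v k 0) @^-1` (ball c e)).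
      by apply: open_comp; [move=> v _; exact: coord_continuous|exact: ball_open].
    by apply/seteqP; split=> v /=; rewrite /ball /= distrC.
  exact: openI (op 0 p.1) (op 1 p.2).
apply/seteqP; split=> u /=; have [h0 h1] := unit_squareE u.
  move=> [[s t] /= [hs ht xE] [se te]].
  by apply/SQ; rewrite -/(pt sigma tau i u) pt_ptc QE//; exists s, t.
move=> /SQ; rewrite -/(pt sigma tau i u) pt_ptc QE// => -[s [t [hs ht xE se te]]].
by exists (s, t).
Qed.

(** A common point of the stars gives, in one square, representatives of [x] and [y] that differ by
    integers and by less than 1. *)
Lemma star_disjoint (x y z : X) (e a b : R) : ov x a b -> ov y a b ->
  gap e a -> gap e b -> star e x z -> star e y z -> x = y.
Proof.
move=> xo yo ga gb.
have [Q [SQ QE]] := star_descent xo ga gb.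
have [Q' [SQ' QE']] := star_descent yo ga gb.
move=> /SQ + /SQ'.
have [i [s [t [hs ht ->]]]] := surfaceP z.
rewrite QE// QE'// => -[s1 [t1 [hs1 ht1 xE se1 te1]]] [s2 [t2 [hs2 ht2 yE se2 te2]]].
have e2 : e <= 2^-1 by case: ga.
have cl (u v w : R) : `|w - u| < e -> `|w - v| < e -> `|u - v| < 1.
  move=> h1 h2; rewrite (_ : u - v = (w - v) - (w - u)); last by lra.
  by apply: (le_lt_trans (ler_normB _ _)); lra.
have := ov_ptc i hs2 ht2; rewrite -yE => /(ov_uniq yo)[h1 h2].
have := ov_ptc i hs1 ht1; rewrite -xE => /(ov_uniq xo)[h1' h2'].
have s12 : s1 = s2.
  apply: int_eq; last exact: cl se1 se2.
  by rewrite (_ : s1 - s2 = (a - s2) - (a - s1)); [exact: rpredB|lra].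
have t12 : t1 = t2.
  apply: int_eq; last exact: cl te1 te2.
  by rewrite (_ : t1 - t2 = (b - t2) - (b - t1)); [exact: rpredB|lra].
by rewrite xE yE s12 t12.
Qed.

(** The base point is moved across sides until it has room ahead in the direction of the
    displacement. This puts its coordinates in half-open unit intervals, where they are determined
    modulo 1. *)
Lemma disp_normal (i : 'I_n) (s t d1 d2 : R) : 0 <= s <= 1 -> 0 <= t <= 1 ->
  0 <= s + d1 <= 1 -> 0 <= t + d2 <= 1 ->
  exists j s' t', [/\ 0 <= s' <= 1 /\ 0 <= t' <= 1,
    0 <= s' + d1 <= 1 /\ 0 <= t' + d2 <= 1,
    (if 0 <= d1 then s' < 1 else 0 < s'),
    (if 0 <= d2 then t' < 1 else 0 < t') &
    ptc sigma tau i s t = ptc sigma tau j s' t' /\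
    ptc sigma tau i (s + d1) (t + d2) = ptc sigma tau j (s' + d1) (t' + d2)].
Proof.
move=> hs ht hs' ht'.
have hx : exists j s', [/\ 0 <= s' <= 1, 0 <= s' + d1 <= 1,
    (if 0 <= d1 then s' < 1 else 0 < s') &
    forall y, ptc sigma tau i s y = ptc sigma tau j s' y /\
      ptc sigma tau i (s + d1) y = ptc sigma tau j (s' + d1) y].
  have [d10|d10] := leP 0 d1; last by exists i, s; split=> //; lra.
  have [s1|s1] := ltP s 1; first by exists i, s.
  have -> : d1 = 0 by lra.
  have {s1}-> : s = 1 by lra.
  by exists (sigma i), 0; rewrite !addr0 ltr01 lexx ler01; split=> // y; rewrite ptc_right.
have [j [s' [hs1 hs2 s'P h]]] := hx.
case: (boolP (0 <= d2)) => d20; last first.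
  by exists j, s', t; split=> //; first lra; split; apply h.
have [t1|t1] := ltP t 1; first by exists j, s', t; split=> //; split; apply h.
have {}d20 : d2 = 0 by lra.
have {}t1 : t = 1 by lra.
exists (tau j), s', 0; subst t d2; rewrite !addr0 ltr01 lexx ler01; split=> //.
by rewrite -!ptc_top; apply h.
Qed.

(** After [disp_normal] both displacements start from the same coordinates, and at a regular point
    [regular_inj] then gives the same square. *)
Lemma disp_regular e (x y y' : X) (d1 d2 : R) : ~ zeros x ->
  disp e x y d1 d2 -> disp e x y' d1 d2 -> y = y'.
Proof.
move=> xr [i [s [t [[hs ht] [hs' ht'] [xE yE] _ _]]]].
move=> [i' [s' [t' [[ks kt] [ks' kt'] [xE' yE'] _ _]]]].
have [j [u [v [[hu hv] _ Pu Pv [e1 e2]]]]] := disp_normal i hs ht hs' ht'.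
have [j' [u' [v' [[hu' hv'] _ Pu' Pv' [e1' e2']]]]] := disp_normal i' ks kt ks' kt'.
rewrite yE yE' e2 e2'.
have [h1 h2] : u - u' \is a Num.int /\ v - v' \is a Num.int.
  apply: (@ov_uniq x); first by rewrite xE e1; exact: ov_ptc.
  by rewrite xE' e1'; exact: ov_ptc.
have uu : u = u'.
  by apply: int_eq => //; move: Pu Pu'; case: ifP => _ *; rewrite ltr_norml; lra.
have vv : v = v'.
  by apply: int_eq => //; move: Pv Pv'; case: ifP => _ *; rewrite ltr_norml; lra.
subst u' v'.
suff -> : j = j' by [].
by apply: (regular_inj xr hu hv); rewrite -?e1 -?e1'.
Qed.

(** Every quadrant of directions at [x] is entered through some square; the booleans choose the
    signs. *)
Lemma disp_exists (x : X) (b1 b2 : bool) : exists i s t,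
  [/\ 0 <= s <= 1, 0 <= t <= 1, x = ptc sigma tau i s t,
  (if b1 then s < 1 else 0 < s) & (if b2 then t < 1 else 0 < t)].
Proof.
have [i [s [t [hs ht ->]]]] := surfaceP x.
have hx : exists j s', [/\ 0 <= s' <= 1, (if b1 then s' < 1 else 0 < s') &
    ptc sigma tau i s t = ptc sigma tau j s' t].
  case: b1.
    have [s1|s1] := ltP s 1; first by exists i, s.
    by exists (sigma i), 0; rewrite -ptc_right (_ : s = 1); [split=> //; lra|lra].
  have [s1|s1] := ltP 0 s; first by exists i, s.
  exists (sigma^-1%g i), 1; rewrite ptc_right permKV (_ : s = 0); [split=> //; lra|lra].
have [j [s' [hs' Ps' ->]]] := hx.
case: b2.
  have [t1|t1] := ltP t 1; first by exists j, s', t.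
  by exists (tau j), s', 0; rewrite -ptc_top (_ : t = 1); [split=> //; lra|lra].
have [t1|t1] := ltP 0 t; first by exists j, s', t.
exists (tau^-1%g j), s', 1; rewrite ptc_top permKV (_ : t = 0); [split=> //; lra|lra].
Qed.

End Gluing.

(** * Unique lifting and gluing of maps *)

(** The two local hypotheses say that [B] is open and closed relative to [D]. *)
Lemma connected_all (T : topologicalType) (D B : set T) (z0 : T) :
  connected D -> D z0 -> B z0 ->
  (forall z, D z -> B z -> \forall y \near within D (nbhs z), B y) ->
  (forall z, D z -> ~ B z -> \forall y \near within D (nbhs z), ~ B y) ->
  forall z, D z -> B z.
Proof.
move=> cD D0 B0 oB oNB.
suff <- : B `&` D = D by move=> z [].
apply: cD; first by exists z0.
- exists [set y | D y -> B y]°; first exact: open_interior.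
  apply/seteqP; split=> y [].
    by move=> By Dy; split=> //; exact: oB.
  by move=> Dy /interior_subset /(_ Dy).
exists (~` [set y | D y -> ~ B y]°).
  by apply: open_closedC; exact: open_interior.
apply/seteqP; split=> y [].
  by move=> By Dy; split=> // /interior_subset /(_ Dy).
by move=> Dy nB; split=> //; apply: contrapT => NBy; apply: nB; exact: oNB.
Qed.

(** Used for the shears, whose two affine pieces meet along a diagonal of the square. *)
Lemma continuous_if (R : realType) (T Z : topologicalType) (u : T -> R) (f g : T -> Z) :
  continuous u -> continuous f -> continuous g ->
  (forall z, u z = 0 -> f z = g z) ->
  continuous (fun z => if u z <= 0 then f z else g z).
Proof.
move=> cu cf cg fg z V /=.
have [uz|uz|uz] := ltgtP (u z) 0 => nV.
- have h0 : nbhs z (u @^-1` [set y | y < 0]) := cu z _ (lt_nbhsl uz).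
  change (nbhs z [set y | V (if u y <= 0 then f y else g y)]).
  have H1 : nbhs z (f @^-1` V) := cf z V nV.
  have H : nbhs z [set y | u y < 0 /\ V (f y)] by exact: filterI h0 H1.
  apply: filterS H => y [/= uy Vy].
  by rewrite ltW.
- have h0 : nbhs z (u @^-1` [set y | 0 < y]) := cu z _ (lt_nbhsr uz).
  change (nbhs z [set y | V (if u y <= 0 then f y else g y)]).
  have H1 : nbhs z (g @^-1` V) := cg z V nV.
  have H : nbhs z [set y | 0 < u y /\ V (g y)] by exact: filterI h0 H1.
  apply: filterS H => y [/= uy Vy].
  by rewrite leNgt uy.
- have nV' : nbhs (g z) V by rewrite -fg.
  change (nbhs z [set y | V (if u y <= 0 then f y else g y)]).
  have H1 : nbhs z (f @^-1` V) := cf z V nV.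
  have H2 : nbhs z (g @^-1` V) := cg z V nV'.
  have H : nbhs z [set y | V (f y) /\ V (g y)] by exact: filterI H1 H2.
  apply: filterS H => y [/= Vf Vg].
  by case: ifP.
Qed.

Section Lifting.
Context (R : realType) (n : nat) (sigma tau : 'S_n).
Local Notation X := (surface R sigma tau).

Lemma disp_ov e (x y : X) (a b a' b' d1 d2 : R) : e <= 2^-1 ->
  ov x a b -> ov y a' b' -> disp e x y d1 d2 ->
  `|a' - a| < 2^-1 -> `|b' - b| < 2^-1 -> d1 = a' - a /\ d2 = b' - b.
Proof.
move=> e2 xo yo xy ha hb.
have [h1 h2] := ov_uniq (ov_disp xo xy) yo.
have [_ [_ [_ [_ _ _ d1e d2e]]]] := xy.
have E (c c' d : R) : `|c' - c| < 2^-1 -> `|d| < e -> c + d - c' \is a Num.int -> d = c' - c.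
  move=> hc hd hi; apply: int_eq.
    by rewrite (_ : _ - _ = c + d - c') //; lra.
  by apply: (le_lt_trans (ler_normB _ _)); lra.
by split; exact: E.
Qed.

Lemma gap_exists2 (a b : R) : exists e, gap e a /\ gap e b.
Proof.
have [e1 g1] := gap_exists a; have [e2 g2] := gap_exists b.
have p1 : 0 < e1 by case: g1.
have p2 : 0 < e2 by case: g2.
exists (Num.min e1 e2); split.
  by apply: gapS g1; rewrite ?lt_min ?p1 ?p2 // ge_min lexx.
by apply: gapS g2; rewrite ?lt_min ?p1 ?p2 // ge_min lexx orbT.
Qed.

(** The coincidence set is open because off the zeros a displacement determines its end point
    ([disp_regular]), and its complement is open because distinct points of a fibre have disjoint
    stars ([star_disjoint]). *)
Lemma lift_unique (T : topologicalType) (D : set T) (F G : T -> X) (a b : T -> R) (z0 : T) :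
  connected D -> {within D, continuous F} -> {within D, continuous G} ->
  {within D, continuous a} -> {within D, continuous b} ->
  (forall z, D z -> ov (F z) (a z) (b z)) ->
  (forall z, D z -> ov (G z) (a z) (b z)) ->
  (forall z, D z -> ~ zeros (F z)) ->
  D z0 -> F z0 = G z0 -> forall z, D z -> F z = G z.
Proof.
move=> cD /subspace_continuousP cF /subspace_continuousP cG
  /subspace_continuousP ca /subspace_continuousP cb oF oG rF D0 FG0.
have nst z : D z -> exists e, [/\ gap e (a z), gap e (b z) &
    \forall y \near within D (nbhs z), [/\ star e (F z) (F y), star e (G z) (G y),
      `|a y - a z| < 2^-1 & `|b y - b z| < 2^-1]].
  move=> Dz; have [e [ga gb]] := gap_exists2 (a z) (b z).
  exists e; split=> //.
  have h1 := cF z Dz _ (star_nbhs (oF _ Dz) ga gb).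
  have h2 := cG z Dz _ (star_nbhs (oG _ Dz) ga gb).
  have p2 : 0 < (2^-1 : R) by rewrite invr_gt0.
  have h3 := ca z Dz _ (nbhsx_ballx (a z) _ p2).
  have h4 := cb z Dz _ (nbhsx_ballx (b z) _ p2).
  near=> y; split; [near: y; exact: h1|near: y; exact: h2| |].
    by rewrite distrC; near: y; exact: h3.
  by rewrite distrC; near: y; exact: h4.
apply: (connected_all cD D0 FG0) => z Dz FGz.
  have [e [ga gb h]] := nst z Dz.
  have e2 : e <= 2^-1 by case: ga.
  have hD : \forall y \near within D (nbhs z), D y by exact: withinT.
  near=> y.
  have Dy : D y by near: y.
  have [[d1 [d2 Fd]] [d1' [d2' Gd]] ya yb] : [/\ star e (F z) (F y), star e (G z) (G y),
      `|a y - a z| < 2^-1 & `|b y - b z| < 2^-1] by near: y.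
  have [ea eb] := disp_ov e2 (oF _ Dz) (oF _ Dy) Fd ya yb.
  have [ea' eb'] := disp_ov e2 (oG _ Dz) (oG _ Dy) Gd ya yb.
  by subst d1 d2 d1' d2'; rewrite -FGz in Gd; apply: (disp_regular (rF _ Dz) Fd Gd).
have [e [ga gb h]] := nst z Dz.
near=> y => FGy; apply: FGz.
have [h1 h2 _ _] : [/\ star e (F z) (F y), star e (G z) (G y),
      `|a y - a z| < 2^-1 & `|b y - b z| < 2^-1] by near: y.
by apply: (star_disjoint (oF _ Dz) (oG _ Dz) ga gb h1); rewrite FGy.
Unshelve. all: by end_near. Qed.

Lemma glue_map (Z : topologicalType) (phi : 'I_n -> R -> R -> Z) :
  (forall i, continuous (fun z : R * R => phi i z.1 z.2)) ->
  (forall i y, 0 <= y <= 1 -> phi i 1 y = phi (sigma i) 0 y) ->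
  (forall i x, 0 <= x <= 1 -> phi i x 1 = phi (tau i) x 0) ->
  exists h : X -> Z, continuous h /\
    forall i x y, 0 <= x <= 1 -> 0 <= y <= 1 -> h (ptc sigma tau i x y) = phi i x y.
Proof.
move=> cphi cr ct.
have [h hE] := ptc_descent cr ct.
exists h; split=> //.
apply/(@quotient_continuous (squares R n) {eq_quot (glued_equiv R sigma tau)} Z h).
move=> [i u].
have cv k : (fun w : set_type (unit_square R) => set_val w k 0) @ nbhs u --> set_val u k 0.
  apply: (@cvg_comp _ _ _ set_val (fun w : 'cV[R]_2 => w k 0)); last exact: coord_continuous.
  exact: initial_continuous.
have cw : (fun w : set_type (unit_square R) => phi i (set_val w 0 0) (set_val w 1 0)) @ nbhs u
    --> phi i (set_val u 0 0) (set_val u 1 0).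
  exact: (cvg_comp _ _ (cvg_pair (cv 0) (cv 1)) (cphi i (set_val u 0 0, set_val u 1 0))).
have hpt w : h (pt sigma tau i w) = phi i (set_val w 0 0) (set_val w 1 0).
  by have [h0 h1] := unit_squareE w; rewrite pt_ptc hE.
move=> W; rewrite /= -/(pt sigma tau i u) hpt => nW.
change (nbhs u [set w | W (h (pt sigma tau i w))]).
have H : nbhs u [set w : set_type (unit_square R) | W (phi i (set_val w 0 0) (set_val w 1 0))] := cw _ nW.
by apply: filterS H => w /=; rewrite hpt.
Qed.

End Lifting.

(** * Affine maps between square-tiled surfaces *)

Section Homeo.
Context (R : realType) (n : nat).
Implicit Types s t : 'S_n.

Definition homeo (T U : topologicalType) (h : T -> U) (h' : U -> T) :=
  [/\ cancel h h', cancel h' h, continuous h & continuous h'].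

Lemma homeo_comp (T U V : topologicalType) (h : T -> U) (h' : U -> T) (k : U -> V) (k' : V -> U) :
  homeo h h' -> homeo k k' -> homeo (k \o h) (h' \o k').
Proof.
move=> [hK h'K ch ch'] [kK k'K ck ck']; split; [exact: can_comp|exact: can_comp| |].
  by move=> x; exact: continuous_comp (ch x) (ck _).
by move=> x; exact: continuous_comp (ck' x) (ch' _).
Qed.

(* h lifts the linear map of the torus with matrix [[p, q], [r, u]]. *)
Definition covers s t s' t' (h : surface R s t -> surface R s' t') (p q r u : R) :=
  forall x a b, ov x a b -> ov (h x) (p * a + q * b) (r * a + u * b).

Lemma covers_ptc s t s' t' (h : surface R s t -> surface R s' t') (p q r u : R) :
  p \is a Num.int -> q \is a Num.int -> r \is a Num.int -> u \is a Num.int ->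
  (forall i x y, 0 <= x <= 1 -> 0 <= y <= 1 ->
    ov (h (ptc s t i x y)) (p * x + q * y) (r * x + u * y)) -> covers h p q r u.
Proof.
move=> pi qi ri ui hE x a b /ovP[i [y [z [hy hz -> [ha hb]]]]].
apply: (ov_shift (hE i y z hy hz)).
  rewrite (_ : _ - _ = p * (a - y) + q * (b - z)); last by ring.
  by rewrite rpredD ?rpredM.
rewrite (_ : _ - _ = r * (a - y) + u * (b - z)); last by ring.
by rewrite rpredD ?rpredM.
Qed.

Lemma covers_comp s t s' t' s'' t'' (h : surface R s t -> surface R s' t')
    (k : surface R s' t' -> surface R s'' t'') (p q r u p' q' r' u' : R) :
  covers h p q r u -> covers k p' q' r' u' ->
  covers (k \o h) (p' * p + q' * r) (p' * q + q' * u) (r' * p + u' * r) (r' * q + u' * u).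
Proof.
move=> ch ck x a b /ch /ck /= h1; apply: (ov_shift h1).
  by rewrite (_ : _ - _ = 0) ?rpred0//; ring.
by rewrite (_ : _ - _ = 0) ?rpred0//; ring.
Qed.

(** The adjugate matrix is integral, so it sends the integral discrepancy between the two lifts of a
    point to an integral one. *)
Lemma covers_inv s t s' t' (h : surface R s t -> surface R s' t') h' (p q r u : R) :
  p \is a Num.int -> q \is a Num.int -> r \is a Num.int -> u \is a Num.int ->
  p * u - q * r = 1 -> covers h p q r u -> cancel h' h -> covers h' u (- q) (- r) p.
Proof.
move=> pi qi ri ui d ch hK y a b yo.
have [c [e xo]] := ov_ex (h' y).
have := ch _ _ _ xo; rewrite hK => /(ov_uniq yo)[h1 h2].
apply: (ov_shift xo).
  rewrite (_ : _ - _ = u * (a - (p * c + q * e)) - q * (b - (r * c + u * e))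
     + (p * u - q * r - 1) * c); last by ring.
  by rewrite d subrr mul0r addr0 rpredB ?rpredM.
rewrite (_ : _ - _ = p * (b - (r * c + u * e)) - r * (a - (p * c + q * e))
     + (p * u - q * r - 1) * e); last by ring.
by rewrite d subrr mul0r addr0 rpredB ?rpredM.
Qed.

Lemma continuous_affine2 (a b c : R) : continuous (fun z : R * R => a * z.1 + b * z.2 + c).
Proof.
move=> z; apply: cvgD; last exact: cvg_cst.
by apply: cvgD; apply: cvgMr; [exact: cvg_fst|exact: cvg_snd].
Qed.

Lemma continuous_ptc_affine s t i (a b c d e f : R) :
  continuous (fun z : R * R => ptc s t i (a * z.1 + b * z.2 + c) (d * z.1 + e * z.2 + f)).
Proof. by move=> z; apply: ptc_cvg; exact: continuous_affine2. Qed.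

Lemma surface_ext s t (U : Type) (f g : surface R s t -> U) :
  (forall i x y, 0 <= x <= 1 -> 0 <= y <= 1 -> f (ptc s t i x y) = g (ptc s t i x y)) ->
  f =1 g.
Proof. by move=> h x; have [i [a [b [ha hb ->]]]] := surfaceP x; exact: h. Qed.

Lemma flip_exists s t : exists h : surface R s t -> surface R t s,
  continuous h /\ forall i x y, 0 <= x <= 1 -> 0 <= y <= 1 -> h (ptc s t i x y) = ptc t s i y x.
Proof.
apply: (@glue_map R n s t (surface R t s) (fun i x y => ptc t s i y x)).
- move=> i z; apply: ptc_cvg; [exact: cvg_snd|exact: cvg_fst].
- by move=> i y _; rewrite ptc_top.
- by move=> i y _; rewrite ptc_right.
Qed.

Lemma homeo_from_ptc s t s' t' (h : surface R s t -> surface R s' t') (h' : surface R s' t' -> surface R s t) :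
  continuous h -> continuous h' ->
  (forall i x y, 0 <= x <= 1 -> 0 <= y <= 1 -> h' (h (ptc s t i x y)) = ptc s t i x y) ->
  (forall i x y, 0 <= x <= 1 -> 0 <= y <= 1 -> h (h' (ptc s' t' i x y)) = ptc s' t' i x y) ->
  homeo h h'.
Proof.
move=> ch ch' e1 e2; split=> //.
  exact: (@surface_ext _ _ _ (h' \o h) id).
exact: (@surface_ext _ _ _ (h \o h') id).
Qed.

Lemma relabel_exists s t (w : 'S_n) :
  exists h h', [/\ @homeo (surface R (w * s * w^-1)%g (w * t * w^-1)%g) (surface R s t) h h',
    covers h 1 0 0 1 &
    forall i x y, 0 <= x <= 1 -> 0 <= y <= 1 -> h (ptc _ _ i x y) = ptc s t (w i) x y].
Proof.
have [|||h [ch hE]] := @glue_map R n (w * s * w^-1)%g (w * t * w^-1)%g (surface R s t)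
    (fun i x y => ptc s t (w i) x y).
- by move=> i z; apply: ptc_cvg; [exact: cvg_fst|exact: cvg_snd].
- by move=> i y _; rewrite ptc_right !permM permKV.
- by move=> i y _; rewrite ptc_top !permM permKV.
have [|||h' [ch' h'E]] := @glue_map R n s t (surface R (w * s * w^-1)%g (w * t * w^-1)%g)
    (fun i x y => ptc _ _ (w^-1%g i) x y).
- by move=> i z; apply: ptc_cvg; [exact: cvg_fst|exact: cvg_snd].
- by move=> i y _; rewrite ptc_right !permM permKV.
- by move=> i y _; rewrite ptc_top !permM permKV.
exists h, h'; split=> //.
  apply: homeo_from_ptc => // i x y hx hy; first by rewrite hE// h'E// permK.
  by rewrite h'E// hE// permKV.
apply: covers_ptc; rewrite ?rpred0 ?rpred1// => i x y hx hy.
by rewrite hE// !mul1r !mul0r addr0 add0r; exact: ov_ptc.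
Qed.

(* Cutting each sheared square along its diagonal and regluing gives back the
   squares of X(s, t). *)
Lemma hshear_exists s t : exists h h',
  [/\ @homeo (surface R s (s * t)%g) (surface R s t) h h', covers h 1 1 0 1 &
   forall i x y, 0 <= x -> 0 <= y <= 1 -> x + y <= 1 ->
     h (ptc s (s * t)%g i x y) = ptc s t i (x + y) y].
Proof.
pose X := surface R s t; pose X' := surface R s (s * t)%g.
have [|||h [ch hE]] := @glue_map R n s (s * t)%g X
    (fun i x y => if 1 * x + 1 * y + -1 <= 0 then ptc s t i (1 * x + 1 * y + 0) (0 * x + 1 * y + 0)
       else ptc s t (s i) (1 * x + 1 * y + -1) (0 * x + 1 * y + 0)).
- move=> i.
  apply: (@continuous_if R _ X (fun z : R * R => 1 * z.1 + 1 * z.2 + -1)).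
  + exact: continuous_affine2.
  + exact: continuous_ptc_affine.
  + exact: continuous_ptc_affine.
  + move=> z z0; rewrite z0 -ptc_right; congr ptc; lra.
- move=> i y hy; case: ifP => h1; case: ifP => h2.
  + have -> : y = 0 by lra.
    by rewrite (_ : 1 * 1 + _ + 0 = 1) ?ptc_right; [congr ptc; lra|lra].
  + by exfalso; lra.
  + by congr ptc; lra.
  + by exfalso; lra.
- move=> i x hx; case: ifP => h1; case: ifP => h2.
  + have x0 : x = 0 by lra.
    transitivity (ptc s t i (1 : R) 1); first by congr ptc; lra.
    by rewrite ptc_right ptc_top -permM; congr ptc; lra.
  + by exfalso; lra.
  + rewrite permM (_ : 0 * x + 1 * 1 + 0 = 1); last by lra.
    rewrite ptc_top; congr ptc; lra.
  + by exfalso; lra.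
have [|||h' [ch' h'E]] := @glue_map R n s t X'
    (fun i x y => if -1 * x + 1 * y + 0 <= 0 then ptc s (s * t)%g i (1 * x + -1 * y + 0) (0 * x + 1 * y + 0)
       else ptc s (s * t)%g (s^-1%g i) (1 * x + -1 * y + 1) (0 * x + 1 * y + 0)).
- move=> i.
  apply: (@continuous_if R _ X' (fun z : R * R => -1 * z.1 + 1 * z.2 + 0)).
  + exact: continuous_affine2.
  + exact: continuous_ptc_affine.
  + exact: continuous_ptc_affine.
  + move=> z z0.
    rewrite (_ : 1 * z.1 + -1 * z.2 + 1 = 1) ?ptc_right ?permKV; last by lra.
    by congr ptc; lra.
- move=> i y hy; case: ifP => h1; case: ifP => h2.
  + rewrite (_ : 1 * 1 + -1 * y + 0 = 1) ?ptc_right; last by lra.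
    by congr ptc; lra.
  + by rewrite permK; congr ptc; lra.
  + by exfalso; lra.
  + by exfalso; lra.
- move=> i x hx; case: ifP => h1; case: ifP => h2.
  + transitivity (ptc s (s * t)%g (s^-1%g i) (1 : R) 1).
      by rewrite ptc_right permKV; congr ptc; lra.
    by rewrite ptc_top permM permKV; congr ptc; lra.
  + by exfalso; lra.
  + rewrite (_ : 0 * x + 1 * 1 + 0 = 1) ?ptc_top; last by lra.
    by rewrite permM permKV; congr ptc; lra.
  + by exfalso; lra.
exists h, h'; split=> //.
- apply: homeo_from_ptc => // i x y hx hy.
    rewrite hE//; case: ifP => h1.
      rewrite h'E; [|lra..]; case: ifP => h2; first by congr ptc; lra.
      by exfalso; lra.
    rewrite h'E; [|lra..]; case: ifP => h2.
      have -> : x = 1 by lra.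
      by rewrite ptc_right; congr ptc; lra.
    by rewrite permK; congr ptc; lra.
  rewrite h'E//; case: ifP => h1.
    rewrite hE; [|lra..]; case: ifP => h2; first by congr ptc; lra.
    by exfalso; lra.
  rewrite hE; [|lra..]; case: ifP => h2.
    have -> : x = 0 by lra.
    rewrite (_ : _ + _ + 0 = 1) ?ptc_right ?permKV; last by lra.
    by congr ptc; lra.
  by rewrite permKV; congr ptc; lra.
- apply: covers_ptc; rewrite ?rpred0 ?rpred1// => i x y hx hy.
  rewrite hE//; case: ifP => h1.
    apply: (ov_shift (ov_ptc _ _ _ _ _)); [lra|lra| |].
      by rewrite (_ : _ - _ = 0) ?rpred0//; lra.
    by rewrite (_ : _ - _ = 0) ?rpred0//; lra.
  apply: (ov_shift (ov_ptc _ _ _ _ _)); [lra|lra| |].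
    by rewrite (_ : _ - _ = 1) ?rpred1//; lra.
  by rewrite (_ : _ - _ = 0) ?rpred0//; lra.
- move=> i x y hx hy hxy; rewrite hE; [|lra..].
  rewrite ifT; last by lra.
  by congr ptc; lra.
Qed.

Lemma flip_homeo s t : exists h h', [/\ @homeo (surface R s t) (surface R t s) h h',
  covers h 0 1 1 0 &
  forall i x y, 0 <= x <= 1 -> 0 <= y <= 1 -> h (ptc s t i x y) = ptc t s i y x].
Proof.
have [h [ch hE]] := flip_exists s t; have [h' [ch' h'E]] := flip_exists t s.
exists h, h'; split=> //.
  by apply: homeo_from_ptc => // i x y hx hy; rewrite ?hE// h'E// hE.
apply: covers_ptc; rewrite ?rpred0 ?rpred1// => i x y hx hy.
by rewrite hE// !mul1r !mul0r addr0 add0r; exact: ov_ptc.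
Qed.

(** The vertical shear is the horizontal one conjugated by the flip that exchanges the coordinates,
    and with them the two permutations. *)
Lemma vshear_exists s t : exists h h',
  [/\ @homeo (surface R (t * s)%g t) (surface R s t) h h', covers h 1 0 1 1 &
   forall i x y, 0 <= x <= 1 -> 0 <= y -> x + y <= 1 ->
     h (ptc (t * s)%g t i x y) = ptc s t i x (x + y)].
Proof.
have [f [f' [hf cf fE]]] := flip_homeo (t * s)%g t.
have [g [g' [hg cg gE]]] := flip_homeo t s.
have [h [h' [hh ch hE]]] := hshear_exists t s.
exists (g \o (h \o f)), ((f' \o h') \o g'); split.
- by apply: homeo_comp => //; apply: homeo_comp.
- move=> x a b xo; have := covers_comp (covers_comp cf ch) cg xo.
  by rewrite !(mul1r, mul0r, mulr1, mulr0, addr0, add0r).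
- move=> i x y hx hy hxy /=.
  by rewrite fE; [|lra..]; rewrite hE; [|lra..]; rewrite gE; [congr ptc|..]; lra.
Qed.

(* The square Q_i is turned by a quarter and put on the left of Q_i, so that its
   bottom side becomes the left side of Q_i. *)
Lemma quarter_exists s t : exists h h',
  [/\ @homeo (surface R (s^-1 * t * s)%g s^-1%g) (surface R s t) h h', covers h 0 (-1) 1 0 &
   forall i x y, 0 <= x <= 1 -> 0 <= y <= 1 ->
     h (ptc (s^-1 * t * s)%g s^-1%g i x y) = ptc s t (s^-1%g i) (1 - y) x].
Proof.
have [|||h [ch hE]] := @glue_map R n (s^-1 * t * s)%g s^-1%g (surface R s t)
    (fun i x y => ptc s t (s^-1%g i) (0 * x + -1 * y + 1) (1 * x + 0 * y + 0)).
- by move=> i; exact: continuous_ptc_affine.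
- move=> i y _; rewrite (_ : 1 * 1 + _ + 0 = 1); last by lra.
  by rewrite ptc_top !permM permK; congr ptc; lra.
- move=> i x _; rewrite (_ : 0 * x + -1 * 0 + 1 = 1); last by lra.
  by rewrite ptc_right permKV; congr ptc; lra.
have [|||h' [ch' h'E]] := @glue_map R n s t (surface R (s^-1 * t * s)%g s^-1%g)
    (fun i x y => ptc _ _ (s i) (0 * x + 1 * y + 0) (-1 * x + 0 * y + 1)).
- by move=> i; exact: continuous_ptc_affine.
- move=> i y _; rewrite (_ : -1 * 0 + 0 * y + 1 = 1); last by lra.
  by rewrite ptc_top permK; congr ptc; lra.
- move=> i x _; rewrite (_ : 0 * x + 1 * 1 + 0 = 1); last by lra.
  by rewrite ptc_right !permM permK; congr ptc; lra.
exists h, h'; split=> //.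
- apply: homeo_from_ptc => // i x y hx hy.
    by rewrite hE// h'E; [|lra..]; rewrite permKV; congr ptc; lra.
  by rewrite h'E// hE; [|lra..]; rewrite permK; congr ptc; lra.
- apply: covers_ptc; rewrite ?rpred0 ?rpred1 ?rpredN1// => i x y hx hy.
  rewrite hE//; apply: (ov_shift (ov_ptc _ _ _ _ _)); [lra|lra| |].
    by rewrite (_ : _ - _ = -1) ?rpredN1//; lra.
  by rewrite (_ : _ - _ = 0) ?rpred0//; lra.
- by move=> i x y hx hy; rewrite hE//; congr ptc; lra.
Qed.

Lemma id_homeo (T : topologicalType) : @homeo T T id id.
Proof. by split=> //; move=> x; exact: cvg_id. Qed.

(** Euclidean algorithm on the rows, by induction on the sum of the entries: subtracting the smaller
    row from the larger one splits a shear off on the left. The target surface changes at each step,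
    and the source of the composite is read off at the end. *)
Lemma affine_exists (p q r u : nat) s t : (p * u = q * r + 1)%N ->
  exists s' t' h h', [/\ @homeo (surface R s' t') (surface R s t) h h',
    covers h p%:R q%:R r%:R u%:R &
    forall i x y, 0 <= x -> 0 <= y -> p%:R * x + q%:R * y <= 1 -> r%:R * x + u%:R * y <= 1 ->
      h (ptc s' t' i x y) = ptc s t i (p%:R * x + q%:R * y) (r%:R * x + u%:R * y)].
Proof.
have [k] := ubnP (p + q + r + u); elim: k => // k IH in p q r u s t *.
move=> pk d.
have [/andP[rp uq]|nrp] := boolP ((r <= p) && (u <= q))%N.
  have [h1 [h1' [hh1 ch1 h1E]]] := hshear_exists s t.
  have [] := IH (p - r)%N (q - u)%N r u s (s * t)%g; [nia|nia|].
  move=> s' [t' [h [h' [hh ch hE]]]].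
  exists s', t', (h1 \o h), (h' \o h1'); split; first exact: homeo_comp.
    move=> x a b xo; have := covers_comp ch ch1 xo.
    by rewrite !natrB// !(mul1r, mul0r, mulr1, mulr0, addr0, add0r) !subrK.
  move=> i x y x0 y0; rewrite /= => h2 h3.
  have rx : 0 <= r%:R * x by rewrite mulr_ge0.
  have uy : 0 <= u%:R * y by rewrite mulr_ge0.
  have pr : 0 <= (p - r)%:R * x by rewrite mulr_ge0.
  have qu : 0 <= (q - u)%:R * y by rewrite mulr_ge0.
  have e1 : (p - r)%:R * x = p%:R * x - r%:R * x by rewrite natrB// mulrBl.
  have e2 : (q - u)%:R * y = q%:R * y - u%:R * y by rewrite natrB// mulrBl.
  rewrite hE//; last by lra.
  rewrite h1E; [congr ptc|..]; lra.
have [/andP[pr qu]|npr] := boolP ((p <= r) && (q <= u))%N.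
  have [h1 [h1' [hh1 ch1 h1E]]] := vshear_exists s t.
  have [] := IH p q (r - p)%N (u - q)%N (t * s)%g t; [nia|nia|].
  move=> s' [t' [h [h' [hh ch hE]]]].
  exists s', t', (h1 \o h), (h' \o h1'); split; first exact: homeo_comp.
    move=> x a b xo; have := covers_comp ch ch1 xo.
    by rewrite !natrB// !(mul1r, mul0r, mulr1, mulr0, addr0, add0r) ![_ + (_ - _)]addrC !subrK.
  move=> i x y x0 y0; rewrite /= => h2 h3.
  have rx : 0 <= p%:R * x by rewrite mulr_ge0.
  have uy : 0 <= q%:R * y by rewrite mulr_ge0.
  have pr' : 0 <= (r - p)%:R * x by rewrite mulr_ge0.
  have qu' : 0 <= (u - q)%:R * y by rewrite mulr_ge0.
  have e1 : (r - p)%:R * x = r%:R * x - p%:R * x by rewrite natrB// mulrBl.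
  have e2 : (u - q)%:R * y = u%:R * y - q%:R * y by rewrite natrB// mulrBl.
  rewrite hE//; last by lra.
  rewrite h1E; [congr ptc|..]; lra.
(* When neither row dominates the other, nonnegative entries and determinant 1 leave only the
   identity. *)
have [-> -> -> ->] : [/\ p = 1, q = 0, r = 0 & u = 1]%N.
  by move: nrp npr; rewrite !negb_and -!ltnNge => nrp npr; split; nia.
exists s, t, id, id; split; first exact: id_homeo.
  by move=> x a b; rewrite !(mul1r, mul0r, addr0, add0r).
by move=> i x y _ _ _ _; rewrite !(mul1r, mul0r, addr0, add0r).
Qed.

End Homeo.

(** * Left codes *)

Section Lines.
Context (R : realType) (n : nat) (s t : 'S_n).
Local Notation X := (surface R s t).

(** The row of squares starting at [j], unrolled: the integral part of [x] counts the squares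
    passed. Truncation is a natural number, so the meaningful range is [x >= 0]. *)
Definition hline (j : 'I_n) (x y : R) : X :=
  ptc s t (iter (Num.truncn x) s j) (x - (Num.truncn x)%:R) y.

Lemma hlineE j m (x y : R) : m%:R <= x <= m.+1%:R ->
  hline j x y = ptc s t (iter m s j) (x - m%:R) y.
Proof.
move=> /andP[mx]; rewrite le_eqVlt => /orP[/eqP ->|xm].
  by rewrite /hline natrK subrr /= -ptc_right -natr1; congr ptc; lra.
by rewrite /hline (@truncn_def _ x m) ?mx.
Qed.

Lemma hline_ov j (x y : R) : 0 <= x -> 0 <= y <= 1 -> ov (hline j x y) x y.
Proof.
move=> x0 hy; have /andP[h1 h2] := truncn_itv x0.
apply: (ov_shift (ov_ptc _ _ _ _ hy)).
- by rewrite -natr1 in h2; lra.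
- by rewrite opprB addrC subrK natr_int.
- by rewrite subrr rpred0.
Qed.

(** At an integer the formula for [hline] changes, and the two neighbouring unit intervals are both
    needed to cover a neighbourhood. *)
Lemma near_unit_intervals (x : R) : 0 < x -> exists m1 m2 : nat,
  [/\ m1%:R <= x <= m1.+1%:R, m2%:R <= x <= m2.+1%:R &
   \forall z \near x, (m1%:R <= z <= m1.+1%:R) || (m2%:R <= z <= m2.+1%:R)].
Proof.
move=> x0; have /andP[] := truncn_itv (ltW x0).
set m := Num.truncn x; rewrite le_eqVlt => /orP[/eqP mx|mx xm]; last first.
  exists m, m; split; [by rewrite !ltW|by rewrite !ltW|].
  near=> z; rewrite orbb; apply/andP; split; apply: ltW; near: z.
    exact: lt_nbhsr.
  exact: lt_nbhsl.
move=> xm.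
have m0 : (0 < m)%N by rewrite -(ltr_nat R) mx.
exists m.-1, m; rewrite prednK//; split.
- by rewrite -mx !ler_nat leq_pred leqnn.
- by rewrite -mx !ler_nat leqnn leqnSn.
have h1 : m.-1%:R < x by rewrite -mx ltr_nat prednK.
near=> z; have [zm|mz] := leP z m%:R.
  by rewrite andbT ltW//; near: z; exact: lt_nbhsr.
by rewrite (ltW mz)/= orbC ltW//; near: z; exact: lt_nbhsl.
Unshelve. all: by end_near. Qed.

Lemma hline_cvg (T : Type) (F : set_system T) (f g : T -> R) (x y : R) j :
  Filter F -> 0 < x -> f @ F --> x -> g @ F --> y ->
  (fun w => hline j (f w) (g w)) @ F --> hline j x y.
Proof.
move=> FF x0 fx gy.
have [m1 [m2 [h1 h2 hn]]] := near_unit_intervals x0.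
have c m : (fun w => ptc s t (iter m s j) (f w - m%:R) (g w)) @ F -->
    ptc s t (iter m s j) (x - m%:R) y.
  by apply: ptc_cvg => //; apply: cvgB => //; exact: cvg_cst.
move=> W nW.
have c1 : F [set w | W (ptc s t (iter m1 s j) (f w - m1%:R) (g w))].
  by apply: c; rewrite -(hlineE j y h1).
have c2 : F [set w | W (ptc s t (iter m2 s j) (f w - m2%:R) (g w))].
  by apply: c; rewrite -(hlineE j y h2).
have c3 : F [set w | (m1%:R <= f w <= m1.+1%:R) || (m2%:R <= f w <= m2.+1%:R)].
  exact: fx hn.
change (F [set w | W (hline j (f w) (g w))]).
apply: filterS (filterI c1 (filterI c2 c3)) => w /= [W1 [W2 /orP[]]] hw.
  by rewrite (hlineE _ _ hw).
by rewrite (hlineE _ _ hw).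
Qed.

End Lines.

Arguments hline {R n} s t j x y.

(** The flip carries the horizontal lines of X(t, s) to the vertical lines of X(s, t). *)
Lemma vline_exists (R : realType) n (s t : 'S_n) j :
  exists V : R -> R -> surface R s t,
  [/\ forall (T : Type) (F : set_system T) (f g : T -> R) (x y : R),
        Filter F -> 0 < y -> f @ F --> x -> g @ F --> y ->
        (fun w => V (f w) (g w)) @ F --> V x y,
      forall x y, 0 <= x <= 1 -> 0 <= y -> ov (V x y) x y &
      forall m x y, 0 <= x <= 1 -> m%:R <= y <= m.+1%:R ->
        V x y = ptc s t (iter m t j) x (y - m%:R)].
Proof.
have [h [h' [[_ _ ch _] hh hE]]] := flip_homeo R t s.
exists (fun x y => h (hline t s j y x)); split.
- move=> T F f g x y FF y0 fx gy.
  move=> W nW; have H := ch _ _ nW.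
  exact: (hline_cvg FF y0 gy fx H).
- move=> x y hx hy; have := hh _ _ _ (hline_ov t s j hy hx).
  by rewrite !mul0r !mul1r addr0 add0r.
- move=> m x y hx hy; rewrite (hlineE _ _ _ _ hy) hE//.
  by rewrite -natr1 in hy; lra.
Qed.

Lemma within_comp (T U V : topologicalType) (A : set T) (B : set U) (f : T -> U) (g : U -> V) :
  {within A, continuous f} -> {within B, continuous g} -> (forall x, A x -> B (f x)) ->
  {within A, continuous (g \o f)}.
Proof.
move=> /subspace_continuousP cf /subspace_continuousP cg AB.
apply/subspace_continuousP => x Ax W nW.
have H1 : nbhs (f x) [set y | B y -> W (g y)] := cg _ (AB _ Ax) _ nW.
have H2 : nbhs x [set y | A y -> B (f y) -> W (g (f y))] := cf _ Ax _ H1.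
change (nbhs x [set y | A y -> W (g (f y))]).
by apply: filterS H2 => y /= h Ay; apply: h => //; exact: AB.
Qed.

Lemma half_not_int (R : realType) : ~ ((2^-1 : R) \is a Num.int).
Proof.
by move=> /norm_intr_ge1; rewrite ger0_norm; [|lra] => /(_ _)/implyP; rewrite lt0r_neq0/=; lra.
Qed.

Lemma scale_small (R : realType) (a b : R) : 0 < b -> exists e : R, 0 < e /\
  forall z, 0 <= z < e -> `|a * z| < 2^-1 /\ b * z < 1.
Proof.
move=> b0.
have s0 : 0 <= `|a| := normr_ge0 _.
pose e : R := (2 * `|a| + b + 1)^-1.
have e0 : 0 < e by rewrite invr_gt0; lra.
exists e; split=> // z /andP[z0 ze].
have E : (2 * `|a| + b + 1) * e = 1 by rewrite divff//; lra.
have ze1 : (2 * `|a| + b + 1) * z < 1.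
  by rewrite -[X in _ < X]E ltr_pM2l//; lra.
have sz : 0 <= `|a| * z by rewrite mulr_ge0.
have hz : 0 <= b * z by rewrite mulr_ge0// ltW.
by rewrite normrM (ger0_norm z0); split; lra.
Qed.

(** * The left code in the direction of the first column of an affine map *)

Section Code.
Context (R : realType) (n : nat) (s t s' t' : 'S_n).
Local Notation X := (surface R s t).
Local Notation X' := (surface R s' t').
Context (h : X' -> X) (h' : X -> X') (p q c d : int).
Hypothesis hh : homeo h h'.
Hypothesis ch : covers h q%:~R c%:~R p%:~R d%:~R.
Hypothesis det : q * d - c * p = 1.
Hypothesis p0 : 0 <= p.
Hypothesis q0 : 0 <= q.
Hypothesis hE : forall i (x : R), 0 <= x <= 1 -> 0 <= q%:~R * x <= 1 -> 0 <= p%:~R * x <= 1 ->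
  h (ptc s' t' i x 0) = ptc s t i (q%:~R * x) (p%:~R * x).

Let detR : q%:~R * d%:~R - c%:~R * p%:~R = 1 :> R.
Proof. by rewrite -!intrM -intrB det. Qed.

Let hK : cancel h h'. Proof. by case: hh. Qed.
Let h'K : cancel h' h. Proof. by case: hh. Qed.
Let hc : continuous h. Proof. by case: hh. Qed.
Let h'c : continuous h'. Proof. by case: hh. Qed.

Let ch' : covers h' d%:~R (- c%:~R) (- p%:~R) q%:~R.
Proof. by apply: covers_inv ch h'K; rewrite ?intr_int. Qed.

Lemma is_gamma_bottom i (g : R -> X) : {within `[0, 1], continuous g} ->
  (forall x, 0 <= x <= 1 -> g x = h (ptc s' t' i x 0)) -> is_gamma p q i g.
Proof.
move=> cg gE; split=> //.
- move=> x hx; rewrite gE// overE !mxE /=.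
  have := ch (ov_ptc s' t' i hx (_ : 0 <= 0 <= 1)); rewrite lexx ler01 => /(_ erefl).
  by rewrite !mulr0 !addr0 !(mulrC _ x).
- move=> x u hx ux; rewrite gE// pt_ptc ux !mxE /= hE//.
  + by rewrite ![x * _]mulrC.
  + by have [+ _] := unit_squareE u; rewrite ux !mxE /= mulrC.
  + by have [_] := unit_squareE u; rewrite ux !mxE /= mulrC.
Qed.

(** The end points are left out because they may be zeros; on the open edge, uniqueness of lifts
    applies as soon as one point is known. *)
Lemma is_gamma_unique i (g : R -> X) : is_gamma p q i g ->
  forall x, 0 < x < 1 -> g x = h (ptc s' t' i x 0).
Proof.
move=> [cg og gE] x hx.
(* At this parameter the point [x0 (q, p)] is still in the unit square, where [is_gamma] prescribes
   the value of [g]. *)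
pose x0 : R := (p%:~R + q%:~R + 1)^-1.
have pR : 0 <= p%:~R :> R by rewrite ler0z.
have qR : 0 <= q%:~R :> R by rewrite ler0z.
have pq : (0 : R) < p%:~R + q%:~R.
  rewrite lt0r addr_ge0// andbT; apply/negP => /eqP pq.
  have p0' : p%:~R = 0 :> R by lra.
  have q0' : q%:~R = 0 :> R by lra.
  by move: detR; rewrite p0' q0' mul0r mulr0 subrr => /esym/eqP; rewrite oner_eq0.
have x00 : 0 < x0 by rewrite invr_gt0; lra.
have x0E : (p%:~R + q%:~R + 1) * x0 = 1 by rewrite divff//; lra.
have px0 : 0 <= p%:~R * x0 by rewrite mulr_ge0// ltW.
have qx0 : 0 <= q%:~R * x0 by rewrite mulr_ge0// ltW.
have pqx0 : 0 < (p%:~R + q%:~R) * x0 by rewrite mulr_gt0.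
have x01 : x0 < 1 by lra.
rewrite -[LHS]h'K; congr h.
suff H : forall y, `]0, 1[%classic y -> ptc s' t' i y 0 = h' (g y).
  by rewrite H//= in_itv.
have sub (y : R) : `]0, 1[%classic y -> 0 <= y <= 1.
  by rewrite /= in_itv /= => /andP[y0 y1]; rewrite !ltW.
apply: (@lift_unique R n s' t' R `]0, 1[%classic _ _ id (fun=> 0) x0).
- by apply/connected_intervalP; exact: interval_is_interval.
- apply: continuous_subspaceT => y; apply: ptc_cvg; [exact: cvg_id|exact: cvg_cst].
- apply: (@within_comp _ _ _ _ setT g h').
  + by apply: continuous_subspaceW cg => y /sub; rewrite /= in_itv.
  + exact: continuous_subspaceT.
  + by [].
- by apply: continuous_subspaceT => y; exact: cvg_id.
- by apply: continuous_subspaceT => y; exact: cvg_cst.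
- by move=> y /sub hy; apply: ov_ptc => //; rewrite lexx ler01.
- move=> y /sub hy; have := og y hy; rewrite overE !mxE /= => /ch' o.
  apply: (ov_shift o).
    rewrite (_ : _ - _ = 0) ?rpred0//.
    transitivity ((1 - (q%:~R * d%:~R - c%:~R * p%:~R)) * y : R); first by ring.
    by rewrite detR subrr mul0r.
  by rewrite (_ : _ - _ = 0) ?rpred0//; ring.
- move=> y hy; apply: (@ov_regular _ _ _ _ _ y 0).
    by apply: ov_ptc; rewrite ?lexx ?ler01//; exact: sub.
  move=> [+ _]; move: hy; rewrite /= in_itv /= => /andP[y0 y1] /norm_intr_ge1.
  by rewrite gtr0_norm// leNgt y1 => /(_ (lt0r_neq0 y0)).
- by rewrite /= in_itv/= x00 x01.
- apply: (can_inj hK); rewrite h'K hE; [|lra..].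
  rewrite (gE x0 (sqc (q%:~R * x0) (p%:~R * x0))); last 2 first.
  + by lra.
  + rewrite [LHS]vecE sqc0 sqc1 !clamp_id; [|lra..].
    by rewrite [RHS]vecE !mxE /= ![x0 * _]mulrC.
  by [].
Qed.


(* [h'] straightens the collar of a left walk: it maps the frame formed by
   (q, p) and its left normal (- p, q) to (1, 0) and (shift, height). *)
Let shift : R := - (d * p + c * q)%:~R.
Let height : R := (p * p + q * q)%:~R.

Let height_gt0 : 0 < height.
Proof.
rewrite ltr0z lt0r; apply/andP; split; last by rewrite addr_ge0 ?mulr_ge0.
apply/negP => /eqP; nia.
Qed.

Let straighten (x : X) (z1 z2 : R) :
  Defs.over x (z1 *: direction R p q + z2 *: direction R q (- p)) ->
  ov (h' x) (z1 + shift * z2) (height * z2).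
Proof.
rewrite overE !mxE /= => /ch' o; apply: (ov_shift o).
  rewrite (_ : _ - _ = 0) ?rpred0//.
  transitivity ((1 - (q%:~R * d%:~R - c%:~R * p%:~R)) * z1 : R).
    by rewrite /shift !(intrD, intrM, intrN); ring.
  by rewrite detR subrr mul0r.
rewrite (_ : _ - _ = 0) ?rpred0//.
by rewrite /height !(intrD, intrM, intrN); ring.
Qed.

Let over_collar (y : X') (z1 z2 : R) : ov y (z1 + shift * z2) (height * z2) ->
  Defs.over (h y) (z1 *: direction R p q + z2 *: direction R q (- p)).
Proof.
move=> /ch o; rewrite overE !mxE /=; apply: (ov_shift o).
  rewrite (_ : _ - _ = 0) ?rpred0//.
  transitivity (((q%:~R * d%:~R - c%:~R * p%:~R) - 1) * z2 * p%:~R : R).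
    by rewrite /shift /height !(intrD, intrM, intrN); ring.
  by rewrite detR subrr !mul0r.
rewrite (_ : _ - _ = 0) ?rpred0//.
transitivity ((1 - (q%:~R * d%:~R - c%:~R * p%:~R)) * z2 * q%:~R : R).
  by rewrite /shift /height !(intrD, intrM, intrN); ring.
by rewrite detR subrr !mul0r.
Qed.

Let collar_small : exists e : R, 0 < e /\ forall z, 0 <= z < e -> `|shift * z| < 2^-1 /\ height * z < 1.
Proof.
exact: scale_small height_gt0.
Qed.

(** [h'] turns the walk into a path above the bottom sides of X(s', t') that starts at the middle of
    the bottom of Q'_i. Unique lifting makes it follow the row [hline] of Q'_i, so the second edge
    is the bottom of Q'_(s' i). *)
Lemma next_left_unique i k : next_left R s t p q i k -> k = s' i.
Proof.
move=> [C [_ _ [e [F [e0 cF oF _ gF]]]]].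
have [e1 [e10 he1]] := collar_small.
pose e2 := Num.min e e1.
have e20 : 0 < e2 by rewrite lt_min e0 e10.
have he2 z : 0 <= z < e2 -> [/\ z < e, `|shift * z| < 2^-1 & height * z < 1].
  by case/andP=> z0; rewrite lt_min => /andP[ze ze1]; have [] := he1 z; rewrite ?z0.
(* The walk is compared with the model along an arch which avoids the marked
   point between the two edges, where lifts are not unique. *)
pose arch (x : R) := e2 * ((x - 2^-1) * (3 / 2 - x)).
pose A : set R := `[2^-1, 3 / 2]%classic.
have Aitv x : A x -> 2^-1 <= x <= 3 / 2 by rewrite /A /= in_itv.
have archP x : A x -> 0 <= arch x < e2.
  move=> /Aitv hx; have h1 : 0 <= (x - 2^-1) * (3 / 2 - x) by rewrite mulr_ge0; lra.
  rewrite /arch mulr_ge0 ?(ltW e20)//= -[X in _ < X]mulr1 ltr_pM2l//; nra.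
have harch x : A x -> 0 <= height * arch x <= 1.
  move=> Ax; have [_ _ h2] := he2 _ (archP _ Ax); have /andP[a0 _] := archP _ Ax.
  by apply/andP; split; [apply: mulr_ge0 a0; exact: ltW|exact: ltW].
have carch : continuous arch.
  move=> x; apply: cvgMr; apply: cvgM.
    by apply: cvgB; [exact: cvg_id|exact: cvg_cst].
  by apply: cvgB; [exact: cvg_cst|exact: cvg_id].
have := gF 1%N k erefl; have := gF 0%N i erefl => /= gi gk.
have ei : h' (F (0 + 2^-1, 0)) = ptc s' t' i 2^-1 0.
  by rewrite (is_gamma_unique gi) ?hK//; lra.
have ek : h' (F (1 + 2^-1, 0)) = ptc s' t' k 2^-1 0.
  by rewrite (is_gamma_unique gk) ?hK//; lra.
have arch0 : arch 2^-1 = 0 by rewrite /arch subrr mul0r mulr0.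
have arch1 : arch (3 / 2) = 0 by rewrite /arch subrr !mulr0.
(* The arch comes down at 3/2, the middle of the second edge. There the model is in square [s' i]
   and the walk in square [k]; the abscissa 1/2 is not an integer, so [ptc_inj] compares the
   labels. *)
suff H : forall x, A x -> hline s' t' i (x + shift * arch x) (height * arch x) = h' (F (x, arch x)).
  have A3 : A (3 / 2) by rewrite /A /= in_itv /=; lra.
  have := H _ A3; rewrite arch1 !mulr0 addr0.
  rewrite (@hlineE _ _ _ _ _ 1); last by lra.
  rewrite (_ : 3 / 2 = 1 + 2^-1 :> R); last by lra.
  rewrite ek (_ : 1 + 2^-1 - 1 = 2^-1 :> R) /=; last by lra.
  move=> /ptc_inj ->//; [lra|lra|].
  by move=> [/half_not_int].
apply: (@lift_unique R n s' t' R A _ _ (fun x => x + shift * arch x) (fun x => height * arch x) 2^-1).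
- exact: segment_connected.
- apply/subspace_continuousP => x Ax.
  have [_ h1 h2] := he2 _ (archP _ Ax).
  apply: hline_cvg.
  + by have := Aitv _ Ax; rewrite ltr_norml in h1; lra.
  + apply: cvg_within_filter; apply: cvgD; first exact: cvg_id.
    by apply: cvgMr; exact: carch.
  + by apply: cvg_within_filter; apply: cvgMr; exact: carch.
- apply: (@within_comp _ _ _ _ setT (fun x => F (x, arch x)) h') => //; last exact: continuous_subspaceT.
  apply: (@within_comp _ _ _ _ _ (fun x => (x, arch x)) F _ cF).
    by apply: continuous_subspaceT => x; exact: (cvg_pair (@cvg_id _ (nbhs x)) (carch x)).
  move=> x Ax /=; have [h1 _ _] := he2 _ (archP _ Ax).
  by have := archP _ Ax; have := Aitv _ Ax; lra.
- apply: continuous_subspaceT => x; apply: cvgD; first exact: cvg_id.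
  by apply: cvgMr; exact: carch.
- by apply: continuous_subspaceT => x; apply: cvgMr; exact: carch.
- move=> x Ax; have [_ h1 h2] := he2 _ (archP _ Ax).
  apply: hline_ov; first by have := Aitv _ Ax; rewrite ltr_norml in h1; lra.
  exact: harch.
- move=> x Ax; apply: straighten.
  apply: (oF (x, arch x)); have [h1 _ _] := he2 _ (archP _ Ax).
  by have := archP _ Ax; have := Aitv _ Ax; rewrite /=; lra.
- move=> x Ax; have [_ h1 h2] := he2 _ (archP _ Ax).
  have /andP[a0 _] := archP _ Ax.
  apply: (@ov_regular _ _ _ _ _ (x + shift * arch x) (height * arch x)).
    apply: hline_ov; first by have := Aitv _ Ax; rewrite ltr_norml in h1; lra.
    exact: harch.
  move=> [i1 i2].
  (* An integral height below 1 is 0, so the arch could meet a marked point only on the boundary. It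
     touches the boundary at 1/2 and 3/2 only, where the abscissa is not an integer. *)
  have a00 : arch x = 0.
    have : height * arch x = 0.
      apply/eqP; apply: contraTT i2 => hN; apply/negP => /norm_intr_ge1 /(_ hN).
      have /andP[h3 _] := harch _ Ax; rewrite ger0_norm//.
      by rewrite leNgt h2.
      by move/eqP; rewrite mulf_eq0 gt_eqF//= => /eqP.
  move: i1; rewrite a00 mulr0 addr0 => xi.
  have : (x - 2^-1) * (3 / 2 - x) = 0.
    by move/eqP: a00; rewrite /arch mulf_eq0 gt_eqF//= => /eqP.
  have -> : x = 1; last by lra.
  apply: int_eq; first by rewrite rpredB ?rpred1.
  by have := Aitv _ Ax; rewrite ltr_norml; lra.
- by rewrite /A /= in_itv /=; lra.
- by rewrite arch0 !mulr0 addr0 (@hlineE _ _ _ _ _ 0) ?subr0; [rewrite -ei add0r|lra].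
Qed.


(** Seen through [h'], all the segments lie at integral height, so points of height strictly between
    0 and 1 are in the complement. *)
Lemma gammas_height (x : X) : @gammas R n s t p q x ->
  exists a, ov (h' x) a 0.
Proof.
move=> [i [g [[_ og _] [y]]]]; rewrite /= in_itv /= => /og + <-.
rewrite overE !mxE /= => /ch' o.
exists (d%:~R * (y * q%:~R) + - c%:~R * (y * p%:~R)); apply: (ov_shift o).
  by rewrite subrr rpred0.
by rewrite (_ : _ - _ = 0) ?rpred0//; ring.
Qed.

Lemma next_left_exists i : next_left R s t p q i (s' i).
Proof.
have [e [e0 he]] := collar_small.
(* The collar may lean to the left, since [shift] can be negative. Starting one square earlier, at
   abscissa 1, keeps the argument of [hline] positive; this is the origin of the index [m.+1]
   below. *)
pose G (x y : R) := h (hline s' t' ((s'^-1)%g i) (1 + x + shift * y) (height * y)).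
pose F (z : R * R) := G z.1 z.2.
have GD x y : 0 <= x -> 0 <= y < e -> 0 < 1 + x + shift * y /\ 0 <= height * y <= 1.
  move=> x0 hy; have [+ h2] := he _ hy; rewrite ltr_norml => h1; split; first by lra.
  by apply/andP; split; [apply: mulr_ge0; [exact: ltW|case/andP: hy]|exact: ltW].
have cG (T : Type) (f : set_system T) (u v : T -> R) (x y : R) : Filter f -> 0 <= x -> 0 <= y < e ->
    u @ f --> x -> v @ f --> y -> (fun w => G (u w) (v w)) @ f --> G x y.
  move=> ff x0 hy ux vy W nW; have H := hc nW.
  have [h1 _] := GD _ _ x0 hy.
  have cu : (fun w => 1 + u w + shift * v w) @ f --> 1 + x + shift * y.
    apply: cvgD; last by apply: cvgMr.
    by apply: cvgD => //; exact: cvg_cst.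
  have cv : (fun w => height * v w) @ f --> height * y by apply: cvgMr.
  exact: (hline_cvg ff h1 cu cv H).
have oG x y : 0 <= x -> 0 <= y < e ->
    ov (h' (G x y)) (x + shift * y) (height * y).
  move=> x0 hy; rewrite /G hK; have [h1 h2] := GD _ _ x0 hy.
  apply: (ov_shift (hline_ov _ _ _ (ltW h1) h2)); last by rewrite subrr rpred0.
  by rewrite (_ : _ - _ = -1) ?rpredN1//; ring.
have nG x y : 0 <= x -> 0 < y < e -> ~ @gammas R n s t p q (G x y).
  move=> x0 /andP[y0 ye] /gammas_height[a oa].
  have hy : 0 <= y < e by rewrite ltW.
  have [_] := ov_uniq (oG _ _ x0 hy) oa; rewrite subr0 => /norm_intr_ge1.
  have [_ h2] := he _ hy.
  rewrite gtr0_norm ?mulr_gt0// mulf_neq0 ?lt0r_neq0// => /(_ erefl).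
  by rewrite leNgt h2.
have e2 : 0 < e / 2 < e by lra.
pose C : set X := connected_component (~` @gammas R n s t p q) (G 0 (e / 2)).
(* Joining a collar point to the base point of [C] by a segment in the parameters keeps the height
   strictly between the boundary values, so the image never meets the segments and stays in one
   component. *)
have CF x y : 0 <= x -> 0 < y < e -> C (G x y).
  move=> x0 hy.
  pose l (r : R) := G (r * x) (e / 2 + r * (y - e / 2)).
  have lE r : 0 <= r <= 1 -> 0 <= r * x /\ 0 < e / 2 + r * (y - e / 2) < e.
    by move=> hr; split; [rewrite mulr_ge0//; lra|nra].
  have : C (l 1).
    apply: (@connected_component_max _ (~` @gammas R n s t p q) (l @` `[0, 1]) (G 0 (e / 2))).
    - exists 0; first by rewrite /= in_itv /=; lra.
      by rewrite /l !mul0r addr0.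
    - move=> _ [r + <-]; rewrite /= in_itv /= => hr; have [h1 h2] := lE _ hr.
      exact: nG.
    - apply: connected_continuous_connected; first exact: segment_connected.
      apply/subspace_continuousP => r; rewrite /= in_itv /= => hr.
      have [h1 h2] := lE _ hr.
      apply: cG => //; first by move/andP: h2 => [h3 h4]; rewrite ltW.
        by apply: cvg_within_filter; apply: cvgMl; exact: cvg_id.
      apply: cvg_within_filter; apply: cvgD; first exact: cvg_cst.
      by apply: cvgMl; exact: cvg_id.
    - by exists 1 => //; rewrite /= in_itv /=; lra.
  by rewrite /l !mul1r addrC subrK.
have walk js : (size js <= 2)%N -> (forall m j, onth js m = Some j -> j = iter m s' i) ->
    left_walk p q C js.
  move=> js2 jsE; exists e, F => E.
  have ED z : E z -> 0 <= z.1 /\ 0 <= z.2 < e by move=> [/andP[z1 _] hz].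
  split=> //.
  - apply/subspace_continuousP => z /ED[h1 h2].
    by apply: cG => //; apply: cvg_within_filter; [exact: cvg_fst|exact: cvg_snd].
  - move=> z /ED[h1 h2]; by have := over_collar (oG _ _ h1 h2); rewrite h'K.
  - by move=> z /ED[h1 /andP[h2 h3]] z2; apply: CF => //; rewrite z2.
  - move=> m j jm; have jE := jsE _ _ jm.
    apply: is_gamma_bottom.
      apply/subspace_continuousP => x; rewrite /= in_itv /= => hx.
      apply: cG; rewrite ?lexx ?e0//.
      + by rewrite addr_ge0//; lra.
      + apply: cvg_within_filter; apply: cvgD; first exact: cvg_cst.
        exact: cvg_id.
      + exact: cvg_cst.
    move=> x hx; rewrite /F /G /= !mulr0 addr0 (@hlineE _ _ _ _ _ m.+1).
      rewrite iterSr permKV -jE; congr (h (ptc _ _ _ _ _)).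
      by rewrite -natr1; ring.
    by rewrite -!natr1; lra.
exists C; split.
- exists (G 0 (e / 2)) => //; exact: nG.
- by apply: walk => // -[|[]]// j [<-].
- by apply: walk => // -[|[|[]]]// j [<-].
Qed.

(** Uniqueness identifies the permutation chosen by [xget], and existence excludes its default
    value. *)
Lemma codeL_affine : codeL R s t p q = s'.
Proof.
rewrite /codeL; case: xgetP => [w _ /= hw|/(_ s')[]].
  by apply/permP => i; exact: next_left_unique.
by move=> i; exact: next_left_exists.
Qed.

End Code.

(** * Charts and derivatives *)

Section Charts.
Context (R : realType) (n : nat) (s t : 'S_n).
Local Notation X := (surface R s t).

Section StarChart.
Context (x : X) (a b e : R).
Hypothesis xr : ~ zeros x.
Hypothesis xo : ov x a b.
Hypothesis ga : gap e a.
Hypothesis gb : gap e b.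

Definition star_coord (y : X) : R * R := xget (0, 0) [set d | disp e x y d.1 d.2].

Definition star_chart (y : X) : 'cV[R]_2 :=
  vec (a + (star_coord y).1) (b + (star_coord y).2).

Lemma star_coordP (y : X) : star e x y -> disp e x y (star_coord y).1 (star_coord y).2.
Proof. by move=> [d1 [d2 h]]; apply: (@xgetPex _ (0, 0) [set d | disp e x y d.1 d.2]); exists (d1, d2). Qed.

Lemma star_coordE (y : X) (d1 d2 : R) : star e x y -> ov y (a + d1) (b + d2) ->
  `|d1| < 2^-1 -> `|d2| < 2^-1 -> star_coord y = (d1, d2).
Proof.
move=> /star_coordP h yo h1 h2.
have e2 : e <= 2^-1 by case: ga.
have [i1 i2] := ov_uniq (ov_disp xo h) yo.
have [_ [_ [_ [_ _ _ k1 k2]]]] := h.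
have E (u v c : R) : `|u| < e -> `|v| < 2^-1 -> c + u - (c + v) \is a Num.int -> u = v.
  move=> hu hv hi; apply: int_eq; first by rewrite (_ : _ - _ = c + u - (c + v))//; ring.
  by apply: (le_lt_trans (ler_normB _ _)); lra.
by rewrite [LHS]surjective_pairing (E _ _ _ k1 h1 i1) (E _ _ _ k2 h2 i2).
Qed.

Lemma star_chart_over (y : X) : star e x y -> Defs.over y (star_chart y).
Proof. by move=> /star_coordP /(ov_disp xo). Qed.

(** A zero has integral coordinates; within the gap this forces the displacement from [x] to be 0,
    so the zero would be [x] itself. *)
Lemma star_regular (y : X) : star e x y -> ~ zeros y.
Proof.
move=> yx yz; apply: xr.
have h := star_coordP yx; move: h; set d1 := _.1; set d2 := _.2 => h.
have [i1 i2] : a + d1 \is a Num.int /\ b + d2 \is a Num.int.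
  apply: contrapT => hN; exact: (ov_regular (ov_disp xo h) hN yz).
have [i [u [v [_ _ [xE yE] k1 k2]]]] := h.
have E (c d : R) : gap e c -> `|d| < e -> c + d \is a Num.int -> d = 0.
  move=> [_ _ gc] de ci; have [//|dN] := eqVneq d 0.
  have cd : c != c + d by rewrite -subr_eq0 opprD addrA subrr sub0r oppr_eq0.
  by have := gc _ ci cd; rewrite opprD addrA subrr sub0r normrN leNgt de.
move: yE; rewrite (E _ _ ga k1 i1) (E _ _ gb k2 i2) !addr0 -xE => yE.
by rewrite -yE.
Qed.

Lemma star_coord_cvg (y : X) : star e x y ->
  (fun z => (star_coord z).1) @ within (star e x) (nbhs y) --> (star_coord y).1 /\
  (fun z => (star_coord z).2) @ within (star e x) (nbhs y) --> (star_coord y).2.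
Proof.
move=> yx; have h := star_coordP yx; move: h; set d1 := _.1; set d2 := _.2 => h.
have [_ [_ [_ [_ _ _ k1 k2]]]] := h.
have yo := ov_disp xo h.
have e2 : e <= 2^-1 by case: ga.
have [e1 [g1 g2]] := gap_exists2 (a + d1) (b + d2).
have e10 : 0 < e1 by case: g1.
have H (r : R) : 0 < r -> \forall z \near within (star e x) (nbhs y),
    `|d1 - (star_coord z).1| < r /\ `|d2 - (star_coord z).2| < r.
  move=> r0.
  (* The terms involving [e] keep the sum of the displacement to [y] and the one from [y] below [e],
     so that the coordinates of nearby points add up. *)
  pose e3 := Num.min (Num.min e1 r) (Num.min (e - `|d1|) (e - `|d2|)).
  have e30 : 0 < e3 by rewrite !lt_min e10 r0 !subr_gt0 k1 k2.
  have e31 : e3 <= e1 by rewrite !ge_min lexx.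
  have e3r : e3 <= r by rewrite !ge_min lexx orbT.
  have e3d1 : e3 <= e - `|d1| by rewrite !ge_min lexx !orbT.
  have e3d2 : e3 <= e - `|d2| by rewrite !ge_min lexx !orbT.
  have := star_nbhs yo (gapS e30 e31 g1) (gapS e30 e31 g2).
  apply: filterS => z [c1 [c2 yz]] zx.
  have [_ [_ [_ [_ _ _ l1 l2]]]] := yz.
  have zo := ov_disp yo yz; rewrite -!addrA in zo.
  rewrite (star_coordE zx zo) /=.
  - by rewrite !opprD !addrA !subrr !sub0r !normrN; split; apply: lt_le_trans e3r.
  - by apply: (le_lt_trans (ler_normD _ _)); lra.
  - by apply: (le_lt_trans (ler_normD _ _)); lra.
split; apply/cvgrPdist_lt => r r0; apply: filterS (H r r0) => z []//.
Qed.

(** Around the image of [y] the chart is inverted separately on four quadrants, each time inside one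
    square that has room in that quadrant. The four inverses together cover a neighbourhood. *)
Lemma star_chart_open (V : set X) : open V -> V `<=` star e x ->
  open (star_chart @` V).
Proof.
move=> oV Vx; rewrite openE => _ [y Vy <-].
have yx := Vx _ Vy.
have h := star_coordP yx; rewrite /star_chart.
move: h; set d1 := _.1; set d2 := _.2 => h.
have [_ [_ [_ [_ _ _ k1 k2]]]] := h.
have yo := ov_disp xo h.
have e2 : e <= 2^-1 by case: ga.
set w0 := vec _ _.
have cw k : (fun w : 'cV[R]_2 => w k 0 - w0 k 0) @ nbhs w0 --> (0 : R).
  rewrite -(subrr (w0 k 0)); apply: cvgB; last exact: cvg_cst.
  exact: coord_continuous.
have H b1 b2 : nbhs w0 [set w : 'cV[R]_2 |
   (if b1 then 0 <= w 0 0 - w0 0 0 else w 0 0 - w0 0 0 < 0) ->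
   (if b2 then 0 <= w 1 0 - w0 1 0 else w 1 0 - w0 1 0 < 0) ->
   (star_chart @` V) w].
  have [i [u [v [hu hv yE Pu Pv]]]] := disp_exists y b1 b2.
  have pV : nbhs w0 [set w : 'cV[R]_2 |
      V (ptc s t i (u + (w 0 0 - w0 0 0)) (v + (w 1 0 - w0 1 0)))].
    have c : (fun w : 'cV[R]_2 => ptc s t i (u + (w 0 0 - w0 0 0)) (v + (w 1 0 - w0 1 0)))
        @ nbhs w0 --> y.
      rewrite yE -[X in _ --> ptc _ _ _ X _]addr0 -[X in _ --> ptc _ _ _ _ X]addr0.
      by apply: ptc_cvg; (apply: cvgD; [exact: cvg_cst|exact: cw]).
    by apply: c; exact: open_nbhs_nbhs.
  pose r1 := Num.min (e - `|d1|) (if b1 then 1 - u else u).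
  pose r2 := Num.min (e - `|d2|) (if b2 then 1 - v else v).
  have r10 : 0 < r1 by rewrite lt_min subr_gt0 k1; case: (b1) Pu => /=; rewrite ?subr_gt0.
  have r20 : 0 < r2 by rewrite lt_min subr_gt0 k2; case: (b2) Pv => /=; rewrite ?subr_gt0.
  have n1 : nbhs w0 [set w : 'cV[R]_2 | `|w 0 0 - w0 0 0| < r1].
    have /cvgrPdist_lt/(_ r1 r10) := cw 0; apply: filterS => w.
    by rewrite sub0r normrN.
  have n2 : nbhs w0 [set w : 'cV[R]_2 | `|w 1 0 - w0 1 0| < r2].
    have /cvgrPdist_lt/(_ r2 r20) := cw 1; apply: filterS => w.
    by rewrite sub0r normrN.
  apply: filterS (filterI pV (filterI n1 n2)) => w [/= Vw [/= w1 w2]] hb1 hb2.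
  have e1 : w0 0 0 = a + d1 := vec0 _ _.
  have e3 : w0 1 0 = b + d2 := vec1 _ _.
  move: w1 w2; rewrite /r1 /r2 !lt_min => /andP[w1 w1'] /andP[w2 w2'].
  pose c1 : R := w 0 0 - w0 0 0; pose c2 : R := w 1 0 - w0 1 0.
  rewrite -/c1 -/c2 in Vw w1 w1' w2 w2' hb1 hb2.
  have hu' : 0 <= u + c1 <= 1.
    by case: b1 hb1 w1' {Pu r1 r10 n1} => hb1; rewrite ltr_norml; lra.
  have hv' : 0 <= v + c2 <= 1.
    by case: b2 hb2 w2' {Pv r2 r20 n2} => hb2; rewrite ltr_norml; lra.
  exists (ptc s t i (u + c1) (v + c2)) => //.
  have d10 := normr_ge0 d1; have d20 := normr_ge0 d2.
  have yy' : disp 1 y (ptc s t i (u + c1) (v + c2)) c1 c2.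
    by exists i, u, v; split=> //; [apply: (lt_le_trans w1); lra|apply: (lt_le_trans w2); lra].
  have y'o := ov_disp yo yy'; rewrite -!addrA in y'o.
  rewrite /star_chart (star_coordE (Vx _ Vw) y'o) /=.
  - by rewrite /c1 /c2 e1 e3 [RHS]vecE; congr vec; ring.
  - by apply: (le_lt_trans (ler_normD _ _)); lra.
  - by apply: (le_lt_trans (ler_normD _ _)); lra.
have h00 := H false false; have h01 := H false true.
have h10 := H true false; have h11 := H true true.
near=> w.
have [x1|x1] := leP 0 (w 0 0 - w0 0 0); have [x2|x2] := leP 0 (w 1 0 - w0 1 0).
- by move: x1 x2; near: w; exact: h11.
- by move: x1 x2; near: w; exact: h10.
- by move: x1 x2; near: w; exact: h01.
- by move: x1 x2; near: w; exact: h00.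
Unshelve. all: by end_near. Qed.

Lemma star_chartP : translation_chart (star e x)° star_chart.
Proof.
have sub : (star e x)° `<=` star e x := @interior_subset _ _.
split.
- exact: open_interior.
- by move=> y /sub /star_regular.
- split.
    apply/subspace_continuousP => y /sub yx; have [c1 c2] := star_coord_cvg yx.
    have cW (F : X -> R) (l : R) : F @ within (star e x) (nbhs y) --> l ->
        F @ within (star e x)° (nbhs y) --> l.
      move=> Fl W nW; have H : nbhs y [set z | star e x z -> W (F z)] := Fl _ nW.
      change (nbhs y [set z | (star e x)° z -> W (F z)]).
      by apply: filterS H => z zA /sub.
    by apply: cvg_vec; (apply: cvgD; [exact: cvg_cst|exact: cW]).
  move=> y z; rewrite !inE => /sub yx /sub zx E.
  have /= e1 := congr1 (fun w : 'cV[R]_2 => w 0 0) E.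
  have /= e3 := congr1 (fun w : 'cV[R]_2 => w 1 0) E.
  move: e1 e3; rewrite !vec0 !vec1 => /addrI e1 /addrI e3.
  have hy := star_coordP yx; have hz := star_coordP zx.
  by rewrite -e1 -e3 in hz; exact: disp_regular xr hy hz.
- by move=> V oV VU; apply: star_chart_open => // y /VU /sub.
- by move=> y /sub; exact: star_chart_over.
Qed.

End StarChart.

Lemma chart_exists (x : X) : ~ zeros x -> exists U phi, translation_chart U phi /\ U x.
Proof.
move=> xr; have [a [b xo]] := ov_ex x; have [e [ga gb]] := gap_exists2 a b.
exists (star e x)°, (star_chart x a b e); split; first exact: star_chartP.
exact: star_nbhs xo ga gb.
Qed.


Lemma translation_chart_at (U : set X) (phi : X -> 'cV[R]_2) (x : X) :
  translation_chart U phi -> U x ->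
  [/\ nbhs x U, phi @ x --> phi x & forall y, U y -> Defs.over y (phi y)].
Proof.
move=> [oU _ [/subspace_continuousP c _] _ h] Ux.
have nU : nbhs x U by exact: open_nbhs_nbhs.
split=> // W nW; have H : nbhs x [set y | U y -> W (phi y)] := c _ Ux _ nW.
change (nbhs x [set y | W (phi y)]).
by apply: filterS (filterI nU H) => y [Uy]; exact.
Qed.

End Charts.

Lemma ord2_ind (P : 'I_2 -> Prop) : P 0 -> P 1 -> forall k, P k.
Proof.
move=> P0 P1 [[|[|//]] h].
  by rewrite (_ : Ordinal h = 0)//; exact: val_inj.
by rewrite (_ : Ordinal h = 1)//; exact: val_inj.
Qed.

Lemma mulmx2E (R : pzRingType) m (B : 'M[R]_2) (v : 'M[R]_(2, m)) i j :
  (B *m v) i j = B i 0 * v 0 j + B i 1 * v 1 j.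
Proof.
rewrite mxE big_ord_recl big_ord1 (_ : lift _ _ = 1)//.
exact/val_inj.
Qed.

Lemma cvg_lin2 (R : realType) (T : Type) (F : set_system T) (f g : T -> R) (a b x y : R) :
  Filter F -> f @ F --> x -> g @ F --> y ->
  (fun w => a * f w + b * g w) @ F --> a * x + b * y.
Proof. by move=> FF fx gy; apply: cvgD; apply: cvgMr. Qed.

Lemma mulmx_continuous (R : realType) (B : 'M[R]_2) :
  continuous (mulmx B : 'cV[R]_2 -> 'cV[R]_2).
Proof.
rewrite (_ : mulmx B = fun w : 'cV[R]_2 =>
    vec (B 0 0 * w 0 0 + B 0 1 * w 1 0) (B 1 0 * w 0 0 + B 1 1 * w 1 0)); last first.
  by apply/funext => w; rewrite [LHS]vecE !mulmx2E.
move=> v; have h k := @coord_continuous R 2 1 k 0 v.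
exact: (cvg_vec _ (cvg_lin2 _ (h 0) (h 1)) (cvg_lin2 _ (h 0) (h 1))).
Qed.

Lemma is_diff_affine (R : realType) (B : 'M[R]_2) (c v : 'cV[R]_2) :
  is_diff v (fun w => B *m w + c) (mulmx B).
Proof.
have H : is_diff v (mulmx B : 'cV[R]_2 -> 'cV[R]_2) (mulmx B).
  apply: DiffDef; first exact/linear_differentiable/mulmx_continuous.
  by rewrite diff_lin //; exact: mulmx_continuous.
have := is_diffD H (is_diff_cst c v).
rewrite addr0 => h; exact: h.
Qed.

Section Affine.
Context (R : realType) (n : nat) (s t : 'S_n).
Local Notation X := (surface R s t).

Definition mx_covers (f : X -> X) (A : 'M[int]_2) :=
  covers f ((A 0 0)%:~R : R) (A 0 1)%:~R (A 1 0)%:~R (A 1 1)%:~R.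

(** In charts, the difference between [f] and the linear map is continuous and varies only by
    integers, hence is constant near [x]. So [f] is read as an affine map. *)
Lemma has_derivative_covers (f : X -> X) (A : 'M[int]_2) (x : X) :
  continuous f -> mx_covers f A -> ~ zeros x -> ~ zeros (f x) ->
  has_derivative f x (map_mx intr A).
Proof.
move=> cf fA xr fxr.
have [U [phi [hU Ux]]] := chart_exists xr.
have [V [psi [hV Vfx]]] := chart_exists fxr.
have [nU cphi ophi] := translation_chart_at hU Ux.
have [nV cpsi opsi] := translation_chart_at hV Vfx.
pose B : 'M[R]_2 := map_mx intr A.
pose c := psi (f x) - B *m phi x.
exists U, V, phi, psi, (fun w => B *m w + c); split; [by split|by split| |exact: is_diff_affine].
have nfV : nbhs x (f @^-1` V) := cf x _ nV.
pose D y := psi (f y) - B *m phi y.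
have Dint y : U y -> V (f y) -> forall k, D y k 0 - c k 0 \is a Num.int.
  have Ik z : U z -> V (f z) -> forall k, D z k 0 \is a Num.int.
    move=> Uz Vz k.
    have := opsi _ Vz; have := ophi _ Uz; rewrite !overE => /fA o1 /ov_uniq /(_ o1)[h1 h2].
    have -> : D z k 0 = psi (f z) k 0 - (B *m phi z) k 0 by rewrite /D !mxE.
    by rewrite mulmx2E !mxE; move: k; apply: ord2_ind.
  by move=> Uy Vy k; rewrite rpredB// ; exact: Ik.
have cpk k : (fun y => phi y k 0) @ x --> phi x k 0.
  by apply: (cvg_comp _ (fun w : 'cV[R]_2 => w k 0) cphi); exact: coord_continuous.
have cfk k : (fun y => psi (f y) k 0) @ x --> psi (f x) k 0.
  have H : (fun z => psi z k 0) @ f x --> psi (f x) k 0.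
    by apply: (cvg_comp _ (fun w : 'cV[R]_2 => w k 0) cpsi); exact: coord_continuous.
  by move=> W nW; exact: cf _ _ (H _ nW).
have cDk k : (fun y => D y k 0) @ x --> c k 0.
  have DE : (fun y => D y k 0) =
      (fun y => psi (f y) k 0 - (B k 0 * phi y 0 0 + B k 1 * phi y 1 0)).
    by apply/funext => y; rewrite -mulmx2E /D !mxE.
  rewrite DE (_ : c k 0 = psi (f x) k 0 - (B k 0 * phi x 0 0 + B k 1 * phi x 1 0)); last first.
    by rewrite -mulmx2E /c !mxE.
  exact: (cvgB (cfk k) (cvg_lin2 _ (cpk 0) (cpk 1))).
have nD k : nbhs x [set y | `|c k 0 - D y k 0| < 1].
  by have /cvgrPdist_lt/(_ 1 ltr01) := cDk k.
apply: filterS (filterI (filterI nU nfV) (filterI (nD 0) (nD 1))) => y [[Uy Vy] [h0 h1]].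
have DE : D y = c.
  rewrite [LHS]vecE [RHS]vecE; congr vec; apply: int_eq; rewrite ?(distrC (D y _ _))//; exact: Dint.
by rewrite -DE /D addrC subrK.
Qed.


Lemma det2 (B : 'M[int]_2) : \det B = B 0 0 * B 1 1 - B 0 1 * B 1 0.
Proof.
rewrite (expand_det_row _ 0) big_ord_recl big_ord1 /cofactor !det_mx11 !mxE /=.
rewrite (_ : lift 0 0 = 1); last exact: val_inj.
rewrite (_ : lift 1 0 = 0); last exact: val_inj.
by rewrite /= expr0 expr1 mul1r mulN1r mulrN.
Qed.

Lemma invmx2 (B : 'M[int]_2) : \det B = 1 ->
  [/\ invmx B 0 0 = B 1 1, invmx B 0 1 = - B 0 1, invmx B 1 0 = - B 1 0 & invmx B 1 1 = B 0 0].
Proof.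
move=> d.
pose C : 'M[int]_2 := \matrix_(i, j) (if i == 0 then (if j == 0 then B 1 1 else - B 0 1)
   else (if j == 0 then - B 1 0 else B 0 0)).
suff -> : invmx B = C by rewrite !mxE.
have CB : C *m B = 1%:M.
  apply/matrixP => i j; rewrite mulmx2E !mxE; rewrite det2 in d.
  by move: i j; apply: ord2_ind; apply: ord2_ind; rewrite /= ?mulr1n ?mulr0n -?d; ring.
by rewrite -[LHS]mul1mx -CB mulmxK// unitmxE d unitr1.
Qed.

Lemma affine_diffeo_covers (f g : X -> X) (A : 'M[int]_2) : \det A = 1 ->
  homeo f g -> mx_covers f A -> (forall x, zeros (f x) <-> zeros x) -> affine_diffeo f A.
Proof.
move=> d [fK gK cf cg] fA fz; split=> //; exists g; split; [by split|by split| | |].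
- apply/seteqP; split=> [_ [x xz <-]|x xz]; first exact: (proj2 (fz x)).
  by exists (g x); [apply: (proj1 (fz _)); rewrite gK|exact: gK].
- move=> x xr; exact: (has_derivative_covers cf fA xr (fun h => xr (proj1 (fz x) h))).
- have [i0 i1 i2 i3] := invmx2 d.
  have gA : mx_covers g (invmx A).
    rewrite /mx_covers i0 i1 i2 i3 !intrN.
    apply: covers_inv fA gK; rewrite ?intr_int//.
    by rewrite -!intrM -intrB -det2 d.
  have gz x : zeros (g x) -> zeros x by move=> /(proj2 (fz _)); rewrite gK.
  move=> x xr; exact: (has_derivative_covers cg gA xr (fun h => xr (gz x h))).
Qed.

End Affine.

(** * Transport of straight paths by an affine diffeomorphism *)

Lemma near_open_unit (R : realType) (x : R) : 0 < x < 1 -> nbhs x [set y : R | 0 < y < 1].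
Proof.
move=> /andP[x0 x1]; apply: filterS (filterI (lt_nbhsr x0) (lt_nbhsl x1)) => y [/= y0 y1].
by rewrite y0 y1.
Qed.

(** * Periodic functions of the torus coordinates *)

Section TorusCoordinates.
Context (R : realType).

Lemma trig_2pi_int (y : R) : y \is a Num.int -> cos (2 * pi * y) = 1 /\ sin (2 * pi * y) = 0.
Proof.
have N (k : nat) : cos (2 * pi * k%:R : R) = 1 /\ sin (2 * pi * k%:R : R) = 0.
  elim: k => [|k [IHc IHs]]; first by rewrite mulr0 cos0 sin0.
  rewrite (_ : k.+1%:R = k%:R + 1 :> R); last by rewrite -natr1.
  rewrite mulrDr mulr1 cosD sinD IHc IHs.
  rewrite (_ : 2 * pi = pi *+ 2 :> R); last by rewrite mulr2n; ring.
  by rewrite cos2pi sin2pi !mul0r !mul1r subr0 addr0.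
move=> /intrP[[k|k] ->]; first exact: N.
by rewrite NegzE intrN mulrN cosN sinN; have [-> ->] := N k.+1; rewrite oppr0.
Qed.

(** For the fractional part [z], the double angle formula gives [sin (pi * z) = 0], and the sine is
    positive strictly between 0 and [pi]. *)
Lemma cos_2pi_eq1 (y : R) : cos (2 * pi * y) = 1 -> y \is a Num.int.
Proof.
pose m : R := (Num.floor y)%:~R; pose z := y - m.
have yE : y = z + m by rewrite subrK.
have mi : m \is a Num.int by exact: intr_int.
have [cm sm] := trig_2pi_int mi.
have /andP[f1 f2] := floor_itv y; rewrite intrD1 -/m in f2; rewrite -/m in f1.
rewrite yE mulrDr cosD cm sm mulr1 mulr0 subr0 (_ : 2 * pi * z = pi * z + pi * z); last by ring.
move=> cz.
have s0 : sin (pi * z) = 0.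
  have := cos2Dsin2 (pi * z); move: cz; rewrite cosD -!expr2 => h1 h2.
  by apply/eqP; rewrite -sqrf_eq0; apply/eqP; lra.
suff -> : z = 0 by rewrite add0r.
apply/eqP; apply: contraPT s0 => zN; apply/eqP; rewrite gt_eqF// sin_gt0_pi//.
have z0 : 0 < z by rewrite lt0r zN /z subr_ge0.
by rewrite mulr_gt0 ?pi_gt0//= -[ltRHS]mulr1 ltr_pM2l ?pi_gt0// /z; lra.
Qed.

Context (n : nat) (s t : 'S_n).
Local Notation X := (surface R s t).

Lemma torus_fun_exists (F : R -> R) (k : 'I_2) : continuous F ->
  (forall y m, m \is a Num.int -> F (y + m) = F y) ->
  exists C : X -> R, continuous C /\ forall x v, Defs.over x v -> C x = F (v k 0).
Proof.
move=> cF pF.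
have F01 : F 1 = F 0 by rewrite -[1 in LHS]add0r pF// int_num1.
pose phi (i : 'I_n) (a b : R) := F (if k == 0 then a else b).
have [|||C [cC CE]] := @glue_map R n s t R phi.
- move=> i; rewrite /phi; case: (k == 0) => z.
    by apply: (@continuous_comp _ _ _ fst F); [exact: cvg_fst|exact: cF].
  by apply: (@continuous_comp _ _ _ snd F); [exact: cvg_snd|exact: cF].
- by move=> i y _; rewrite /phi; case: ifP.
- by move=> i y _; rewrite /phi; case: ifP.
exists C; split=> // x v; rewrite overE => /ovP[i [a [b [ha hb -> [ia ib]]]]].
rewrite CE// /phi; move: k {phi cC CE}; apply: ord2_ind => /=.
  by rewrite -(pF a _ ia) addrC subrK.
by rewrite -(pF b _ ib) addrC subrK.
Qed.

End TorusCoordinates.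

Lemma is_derive_coord (R : realType) (G : 'cV[R]_2 -> 'cV[R]_2) (p d : 'cV[R]_2) (M : 'M[R]_2)
    (k : 'I_2) (t0 : R) :
  is_diff p G (mulmx M) ->
  is_derive t0 1 (fun t => G (p + (t - t0) *: d) k 0) ((M *m d) k 0).
Proof.
move=> Gp.
have dG : derivable G p d by exact/diff_derivable/ex_diff.
have DG : 'D_d G p = M *m d by rewrite deriveE ?diff_val//; exact: ex_diff.
have H : (fun h => h^-1 *: ((G \o shift p) (h *: d) - G p)) @ 0^' --> M *m d.
  by rewrite -DG; exact: dG.
have Hk : (fun h => (h^-1 *: ((G \o shift p) (h *: d) - G p)) k 0) @ 0^' --> (M *m d) k 0.
  by apply: (cvg_comp _ (fun w : 'cV[R]_2 => w k 0) H); exact: coord_continuous.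
pose phi t := G (p + (t - t0) *: d) k 0.
have E : (fun h => h^-1 *: ((phi \o shift t0) (h *: 1) - phi t0)) =
    (fun h => (h^-1 *: ((G \o shift p) (h *: d) - G p)) k 0).
  apply/funext => h; rewrite /phi /= !mxE subrr scale0r addr0 [h *: 1]mulr1 addrK.
  by rewrite [p + _]addrC.
apply: DeriveDef.
  by apply/cvg_ex; exists ((M *m d) k 0); rewrite E.
by apply/cvg_lim => //; rewrite E.
Qed.

Section Transport.
Context (R : realType) (n : nat) (s t : 'S_n).
Local Notation X := (surface R s t).
Context (f : X -> X) (B : 'M[int]_2) (g : R -> X) (v0 d : 'cV[R]_2).
Hypothesis cf : continuous f.
Hypothesis hf : forall x, ~ zeros x -> has_derivative f x (map_mx intr B).
Hypothesis cg : {within `[0, 1], continuous g}.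
Hypothesis og : forall z, 0 <= z <= 1 -> Defs.over (g z) (v0 + z *: d).
Hypothesis rg : forall z, 0 <= z <= 1 -> ~ zeros (g z).

Let BR : 'M[R]_2 := map_mx intr B.

Lemma over_uniq (x : X) (v w : 'cV[R]_2) : Defs.over x v -> Defs.over x w ->
  forall k, v k 0 - w k 0 \is a Num.int.
Proof.
by rewrite !overE => h1 /(ov_uniq h1)[h2 h3]; apply: ord2_ind.
Qed.

Lemma over_shift (x : X) (v w : 'cV[R]_2) : Defs.over x v ->
  (forall k, w k 0 - v k 0 \is a Num.int) -> Defs.over x w.
Proof. by rewrite !overE => h1 h2; apply: ov_shift h1 _ _. Qed.

Lemma path_cvg (z0 : R) : 0 < z0 < 1 -> g @ z0 --> g z0.
Proof.
move=> h W nW; have z01 : `[0, 1]%classic z0 by rewrite /= in_itv /= !ltW; case/andP: h.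
have H1 : nbhs z0 [set z | `[0, 1]%classic z -> W (g z)].
  by move/subspace_continuousP: cg => /(_ _ z01 _ nW).
have H2 : nbhs z0 [set z : R | 0 < z < 1].
  exact: near_open_unit.
apply: filterS (filterI H1 H2) => z /= [h1 /andP[h2 h3]].
by apply: h1; rewrite in_itv /= !ltW.
Qed.

(* The cosine makes the difference between a lift of f \o g and the expected
   displacement independent of the chosen lift, hence defined on all of [0, 1]. *)
Lemma transport_local (k : 'I_2) (w z0 : R) : 0 < z0 < 1 ->
  forall c : R -> R, (forall z, 0 <= z <= 1 -> forall v, Defs.over (f (g z)) v ->
    c z = cos (2 * pi * (v k 0 - (w + (BR *m d) k 0 * z)))) ->
  is_derive z0 1 c 0.
Proof.
move=> hz c cE.
have z01 : 0 <= z0 <= 1 by case/andP: hz => *; rewrite !ltW.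
have [U [V [phi [psi [G [[hU Ux] [hV Vfx] GE dG]]]]]] := hf (rg z01).
have [nU cphi ophi] := translation_chart_at hU Ux.
have [nV cpsi opsi] := translation_chart_at hV Vfx.
have cgz := path_cvg hz.
pose kap := phi (g z0) - (v0 + z0 *: d).
have near01 : nbhs z0 [set z : R | 0 <= z <= 1].
  have H2 : nbhs z0 [set z : R | 0 < z < 1].
    exact: near_open_unit.
  by apply: filterS H2 => z /= /andP[h2 h3]; rewrite !ltW.
have nUg : nbhs z0 [set z | U (g z)] := cgz _ nU.
have nVg : nbhs z0 [set z | V (f (g z))] := cgz _ (cf nV).
have nGg : nbhs z0 [set z | psi (f (g z)) = G (phi (g z))] := cgz _ GE.
have cl i : (fun z => phi (g z) i 0 - (v0 i 0 + z * d i 0)) @ z0 --> kap i 0.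
  have -> : kap i 0 = phi (g z0) i 0 - (v0 i 0 + z0 * d i 0) by rewrite /kap !mxE.
  apply: cvgB.
    have H : (fun y => phi y i 0) @ g z0 --> phi (g z0) i 0.
      by apply: (cvg_comp _ (fun w : 'cV[R]_2 => w i 0) cphi); exact: coord_continuous.
    by move=> W nW; exact: cgz _ (H _ nW).
  apply: cvgD; first exact: cvg_cst.
  by apply: cvgMl; exact: cvg_id.
have ncl i : nbhs z0 [set z | `|kap i 0 - (phi (g z) i 0 - (v0 i 0 + z * d i 0))| < 1].
  by have /cvgrPdist_lt/(_ 1 ltr01) := cl i.
have phiE : nbhs z0 [set z | phi (g z) = phi (g z0) + (z - z0) *: d].
  apply: filterS (filterI (filterI near01 nUg) (filterI (ncl 0) (ncl 1))) => z [[/= hz1 Uz] [/= c0 c1]].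
  have D i : kap i 0 - (phi (g z) i 0 - (v0 i 0 + z * d i 0)) \is a Num.int.
    have h1 := over_uniq (ophi _ Ux) (og z01) i; have h2 := over_uniq (ophi _ Uz) (og hz1) i.
    have -> : kap i 0 = phi (g z0) i 0 - (v0 + z0 *: d) i 0 by rewrite /kap !mxE.
    have -> : v0 i 0 + z * d i 0 = (v0 + z *: d) i 0 by rewrite !mxE.
    exact: rpredB.
  have := int_eq (D 0) c0; have := int_eq (D 1) c1; rewrite /kap !mxE => e1 e0.
  rewrite [LHS]vecE [RHS]vecE !mxE; congr vec; lra.
apply: (@near_eq_is_derive _ _ _ (fun z => cos (2 * pi * (G (phi (g z0) + (z - z0) *: d) k 0 - (w + (BR *m d) k 0 * z))))).
  apply: filterS (filterI (filterI near01 nVg) (filterI nGg phiE)) => z [[/= hz1 Vz] [/= e1 e2]].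
  by rewrite -e2 -e1 -(cE _ hz1)//; exact: opsi.
have dphi := is_derive_coord d k z0 dG.
pose theta z : R := 2 * pi * (G (phi (g z0) + (z - z0) *: d) k 0 - (w + (BR *m d) k 0 * z)).
have dtheta : is_derive z0 1 theta 0.
  pose F1 (z : R) := G (phi (g z0) + (z - z0) *: d) k 0.
  have -> : theta = (2 * pi : R) \*: (F1 - (cst w + (BR *m d) k 0 \*: id)) by apply/funext.
  have H := is_deriveZ (2 * pi) (is_deriveB dphi (is_deriveD (is_derive_cst w z0 1)
     (is_deriveZ ((BR *m d) k 0) (is_derive_id z0 (1 : R))))).
  apply: (is_derive_eq H).
  by rewrite add0r [_ *: 1]mulr1 subrr scaler0.
have := is_derive1_comp (is_derive_cos (theta z0)) dtheta.
by rewrite mulr0.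
Qed.

(** No continuous lift of [f \o g] to the plane is constructed. The function [c], the cosine of
    [2 * pi] times the discrepancy of a coordinate, is assembled from periodic functions on the
    surface by the subtraction formula. Its derivative vanishes, so it keeps its initial value 1,
    and the discrepancy is an integer. *)
Lemma transport : exists w, forall z, 0 <= z <= 1 ->
  Defs.over (f (g z)) (w + z *: (BR *m d)).
Proof.
have [a [b o0]] := ov_ex (f (g 0)).
exists (vec a b) => z hz.
have [a' [b' oz]] := ov_ex (f (g z)).
apply: (over_shift oz) => k.
have fgc : {within `[0, 1], continuous (f \o g)}.
  by apply: (@within_comp _ _ _ _ setT g f) => //; exact: continuous_subspaceT.
have cl (F : R -> R) : continuous F -> continuous (fun y => F (2 * pi * y)).
  move=> cF y; apply: (@continuous_comp _ _ _ (fun y => 2 * pi * y) F); last exact: cF.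
  by apply: cvgMr; exact: cvg_id.
have pc (y m : R) : m \is a Num.int -> cos (2 * pi * (y + m)) = cos (2 * pi * y).
  by move=> /trig_2pi_int[cm sm]; rewrite mulrDr cosD cm sm mulr1 mulr0 subr0.
have ps (y m : R) : m \is a Num.int -> sin (2 * pi * (y + m)) = sin (2 * pi * y).
  by move=> /trig_2pi_int[cm sm]; rewrite mulrDr sinD cm sm mulr1 mulr0 addr0.
have [C [cC CE]] := torus_fun_exists s t k (cl _ (@continuous_cos R)) pc.
have [S [cS SE]] := torus_fun_exists s t k (cl _ (@continuous_sin R)) ps.
pose w := vec a b k 0; pose beta := (BR *m d) k 0.
pose c (y : R) := C (f (g y)) * cos (2 * pi * (w + beta * y)) +
  S (f (g y)) * sin (2 * pi * (w + beta * y)).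
have cE y v : Defs.over (f (g y)) v -> c y = cos (2 * pi * (v k 0 - (w + beta * y))).
  by move=> ov; rewrite /c (CE _ _ ov) (SE _ _ ov) mulrBr cosB.
have c0 : c 0 = 1 by rewrite (cE _ _ o0) mulr0 addr0 subrr mulr0 cos0.
have cc : {within `[0, z], continuous c}.
  have cfg : {within `[0, z], continuous (f \o g)}.
    apply: continuous_subspaceW fgc => y; rewrite /= !in_itv /=; lra.
  have cw : continuous (fun y : R => w + beta * y).
    by move=> y; apply: cvgD; [exact: cvg_cst|apply: cvgMr; exact: cvg_id].
  have cT (F : X -> R) : continuous F -> {within `[0, z], continuous (fun y => F (f (g y)))}.
    move=> cF; apply: (@within_comp _ _ _ _ setT (f \o g) F) => //; exact: continuous_subspaceT.
  apply/subspace_continuousP => y yz; apply: cvgD; apply: cvgM.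
  - by move/subspace_continuousP: (cT _ cC); exact.
  - apply: cvg_within_filter; apply: (@continuous_comp _ _ _ (fun y => w + beta * y) (fun y => cos (2 * pi * y))).
      exact: cw.
    exact: cl (@continuous_cos R) _.
  - by move/subspace_continuousP: (cT _ cS); exact.
  - apply: cvg_within_filter; apply: (@continuous_comp _ _ _ (fun y => w + beta * y) (fun y => sin (2 * pi * y))).
      exact: cw.
    exact: cl (@continuous_sin R) _.
have cz : c z = 1.
  have [->//|zN] := eqVneq z 0.
  have z0 : 0 < z by rewrite lt0r zN; case/andP: hz.
  have dc y : y \in `]0, z[%R -> is_derive y 1 c 0.
    rewrite in_itv /= => hy; apply: (@transport_local k w) => [|u hu v]; first by lra.
    exact: cE.
  have [y _] := MVT z0 dc cc.
  by rewrite mul0r c0 => /eqP; rewrite subr_eq0 => /eqP.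
have vk : vec a' b' k 0 - (w + beta * z) \is a Num.int.
  by apply: cos_2pi_eq1; have := cE z (vec a' b') oz; rewrite cz => <-.
have -> : (vec a b + z *: (BR *m d)) k 0 - vec a' b' k 0 = - (vec a' b' k 0 - (w + beta * z)).
  rewrite (_ : (vec a b + z *: (BR *m d)) k 0 = w + z * beta); first by ring.
  by rewrite /w /beta !mxE.
by rewrite rpredN.
Qed.

End Transport.

(** * Codes and Veech groups *)

Section Codes.
Context (R : realType) (n : nat).
Implicit Types (s t : 'S_n) (A : 'M[int]_2).

(* h maps the unit square Q'_i onto the parallelogram of X(s, t) spanned by the
   columns of A at the south-west corner of Q_i, as long as this makes sense inside Q_i. *)
Definition unfolds s t s' t' A (h : surface R s' t' -> surface R s t) :=
  covers h (A 0 0)%:~R (A 0 1)%:~R (A 1 0)%:~R (A 1 1)%:~R /\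
  forall i (x y : R), 0 <= x -> 0 <= y ->
    (A 0 0)%:~R * x + (A 0 1)%:~R * y <= 1 -> (A 1 0)%:~R * x + (A 1 1)%:~R * y <= 1 ->
    h (ptc s' t' i x y) =
      ptc s t i ((A 0 0)%:~R * x + (A 0 1)%:~R * y) ((A 1 0)%:~R * x + (A 1 1)%:~R * y).

Lemma unfolds_exists s t A : SL2plus A -> exists s' t' h h',
  @homeo (surface R s' t') (surface R s t) h h' /\ unfolds A h.
Proof.
move=> [d A0].
have [p Ep] : exists p : nat, A 0 0 = p by exists (absz (A 0 0)); rewrite gez0_abs.
have [q Eq] : exists p : nat, A 0 1 = p by exists (absz (A 0 1)); rewrite gez0_abs.
have [r Er] : exists p : nat, A 1 0 = p by exists (absz (A 1 0)); rewrite gez0_abs.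
have [u Eu] : exists p : nat, A 1 1 = p by exists (absz (A 1 1)); rewrite gez0_abs.
have [] := @affine_exists R n p q r u s t.
  by move: d; rewrite det2 Ep Eq Er Eu; lia.
move=> s' [t' [h [h' [hh ch hE]]]].
by exists s', t', h, h'; rewrite /unfolds Ep Eq Er Eu.
Qed.

(** The first component is [codeL_affine] for [h]. For the second, [h] is preceded by a quarter
    turn, which makes the second column of A the first column of the composite; its other column is
    the opposite of the first column of A, and the determinant is still 1. *)
Lemma codeL_mx_unfolds s t s' t' A (h : surface R s' t' -> surface R s t) h' :
  SL2plus A -> homeo h h' -> unfolds A h ->
  codeL_mx R s t A = (s', (s'^-1 * t' * s')%g).
Proof.
move=> [d A0] hh [ch hE].
rewrite det2 in d.
have AR i j : (0 : R) <= (A i j)%:~R by rewrite ler0z.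
congr pair.
  apply: (codeL_affine hh ch) => //.
  by move=> i x /andP[x0 x1] hx hy; rewrite hE ?mulr0 ?addr0//; lra.
have [k [k' [hk ck kE]]] := quarter_exists R s' t'.
apply: (@codeL_affine _ _ _ _ _ _ (h \o k) (k' \o h') _ _ (- A 0 0) (- A 1 0)) => //.
- exact: homeo_comp.
- have := covers_comp ck ch.
  by rewrite !(mulr0, mulr1, add0r, addr0, mulrN1) -!intrN.
- by rewrite -d; ring.
- move=> i x hx hq hp /=; have /andP[x0 x1] := hx.
  rewrite kE; [|by []|by lra].
  (* The quarter turn puts the bottom side on the right side of Q'_(s'^-1 i), which is the left side
     of Q'_i. *)
  rewrite subr0 ptc_right permKV hE ?mulr0 ?add0r//; lra.
Qed.

Lemma id_unfolds s t : @unfolds s t s t 1%:M id.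
Proof.
by split=> [x a b|i x y _ _ _ _]; rewrite !mxE /= ?mulr1n ?mulr0n !(mul1r, mul0r, addr0, add0r).
Qed.

Lemma SL2plus1 : SL2plus 1%:M.
Proof. by split; [exact: det1|move=> i j; rewrite mxE; case: (i == j)]. Qed.

Lemma zeros_homeo s t s' t' (h : surface R s' t' -> surface R s t) (w : 'S_n) :
  injective h -> (forall i, h (ptc s' t' i 0 0) = ptc s t (w i) 0 0) ->
  forall x, zeros (h x) <-> zeros x.
Proof.
move=> hI hw x; split=> /zerosP[i [j [ij ix jx]]]; apply/zerosP.
  exists (w^-1%g i), (w^-1%g j); rewrite (inj_eq perm_inj); split=> //; apply: hI.
    by rewrite hw permKV.
  by rewrite hw permKV.
exists (w i), (w j); rewrite (inj_eq perm_inj) -!hw; split=> //.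
  by rewrite ix.
by rewrite jx.
Qed.

Lemma unfolds_zeros s t s' t' A (h : surface R s' t' -> surface R s t) :
  injective h -> unfolds A h -> forall x, zeros (h x) <-> zeros x.
Proof.
move=> hI [_ hE]; apply: (zeros_homeo (w := 1%g)) => // i.
by rewrite hE ?perm1 ?mulr0 ?addr0// ler01.
Qed.

(** Relabelling and [h] both permute south-west corners, so their composite preserves the zeros,
    which [affine_diffeo] demands beyond continuity and derivatives. *)
Lemma conjugate_Veech s t s' t' A (h : surface R s' t' -> surface R s t) h' (w : 'S_n) :
  SL2plus A -> homeo h h' -> unfolds A h ->
  s = (w * s' * w^-1)%g -> t = (w * t' * w^-1)%g -> Veech R s t A.
Proof.
move=> [d _] hh hA es et.
have [k [k' [hk ck kE]]] : exists k k', [/\ @homeo (surface R s t) (surface R s' t') k k',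
    covers k 1 0 0 1 &
    forall i x y, 0 <= x <= 1 -> 0 <= y <= 1 -> k (ptc s t i x y) = ptc s' t' (w i) x y].
  by rewrite es et; exact: relabel_exists.
have kI : injective k by case: hk => /can_inj.
have hI : injective h by case: hh => /can_inj.
exists (h \o k); apply: (affine_diffeo_covers d (homeo_comp hk hh)).
  have := covers_comp ck hA.1.
  by rewrite /mx_covers !(mulr0, mulr1, add0r, addr0).
move=> x /=; have kz := zeros_homeo (w := w) kI _ x.
apply: iff_trans (unfolds_zeros hI hA _) (kz _) => i.
by rewrite kE// lexx ler01.
Qed.

End Codes.

(** * From an affine diffeomorphism to a conjugation of the permutations *)

Section AffineDiffeos.
Context (R : realType) (n : nat) (s t : 'S_n).
Local Notation X := (surface R s t).

(** Half-open squares cover the surface, and a point lies in only one of them unless it is a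
    zero. *)
Definition labelled (x : X) (i : 'I_n) := exists u v : R,
  [/\ 0 <= u < 1, 0 <= v < 1 & x = ptc s t i u v].

Lemma labelled_exists x : exists i, labelled x i.
Proof.
have [i [u [v [hu hv -> u1 v1]]]] := disp_exists x true true.
by exists i, u, v; split=> //; lra.
Qed.

Lemma labelled_uniq x i j : ~ zeros x -> labelled x i -> labelled x j -> i = j.
Proof.
move=> xr [u [v [hu hv xE]]] [u' [v' [hu' hv' xE']]].
have [||] := @ov_uniq R n s t x u v u' v'.
- by rewrite xE; apply: ov_ptc; lra.
- by rewrite xE'; apply: ov_ptc; lra.
move=> h1 h2.
have e1 : u = u' by apply: int_eq => //; rewrite ltr_norml; lra.
have e2 : v = v' by apply: int_eq => //; rewrite ltr_norml; lra.
subst u' v'; apply: (regular_inj xr _ _ (esym xE) (esym xE')); lra.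
Qed.

(** The second claim serves to keep a segment away from the south-west corner: a convex combination
    of nonnegative numbers vanishes before its end only if its start is 0. *)
Lemma unit_convex (a b z : R) : 0 <= a < 1 -> 0 <= b < 1 -> 0 <= z <= 1 ->
  0 <= a + z * (b - a) < 1 /\ (a + z * (b - a) = 0 -> z < 1 -> a = 0).
Proof.
move=> /andP[a0 a1] /andP[b0 b1] /andP[z0 z1].
have h1 : 0 <= (1 - z) * a by rewrite mulr_ge0// subr_ge0.
have h2 : 0 <= z * b by rewrite mulr_ge0.
split; last first.
  move=> E zlt; have /eqP : (1 - z) * a = 0 by lra.
  by rewrite mulf_eq0 subr_eq0 gt_eqF//= => /eqP.
apply/andP; split; first by lra.
have [->|zN] := eqVneq z 1; first by lra.
have h3 : 0 < (1 - z) * (1 - a) by rewrite mulr_gt0 ?subr_gt0// lt_neqAle zN.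
have h4 : 0 <= z * (1 - b) by rewrite mulr_ge0// subr_ge0 ltW.
by lra.
Qed.

(** By [transport] both [f \o g] and [m] lie over the same straight path up to an integral
    translation, so [lift_unique] carries their agreement from 0 to 1. *)
Lemma transport_path (f : X -> X) (B : 'M[int]_2) (g m : R -> X) (v0 d v1 e : 'cV[R]_2) :
  continuous f -> (forall x, ~ zeros x -> has_derivative f x (map_mx intr B)) ->
  (forall x, ~ zeros x -> ~ zeros (f x)) ->
  {within `[0, 1], continuous g} ->
  (forall z, 0 <= z <= 1 -> Defs.over (g z) (v0 + z *: d)) ->
  (forall z, 0 <= z <= 1 -> ~ zeros (g z)) ->
  map_mx intr B *m d = e ->
  {within `[0, 1], continuous m} ->
  (forall z, 0 <= z <= 1 -> Defs.over (m z) (v1 + z *: e)) ->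
  f (g 0) = m 0 -> f (g 1) = m 1.
Proof.
move=> cf hf fr cg og rg Bd cm om f0.
have [w] := transport cf hf cg og rg; rewrite Bd => ow.
have i0 : (0 : R) <= (0 : R) <= (1 : R) by lra.
have wv k : v1 k 0 - w k 0 \is a Num.int.
  have h1 := om 0 i0; rewrite -f0 scale0r addr0 in h1.
  by have h2 := ow 0 i0; rewrite scale0r addr0 in h2; exact: over_uniq h1 h2 k.
have itv (z : R) : `[0, 1]%classic z -> 0 <= z <= 1 by rewrite /= in_itv.
have ce (k : 'I_2) : {within `[0, 1]%classic, continuous (fun z : R => v1 k 0 + z * e k 0)}.
  apply: continuous_subspaceT => z; apply: cvgD; first exact: cvg_cst.
  by apply: cvgMl; exact: cvg_id.
have z1 : (`[0, 1]%classic : set R) 1 by rewrite /= in_itv /= ler01 lexx.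
suff H : forall z, `[0, 1]%classic z -> (f \o g) z = m z by exact: H _ z1.
apply: (@lift_unique R n s t R `[0, 1]%classic (f \o g) m
  (fun z => v1 0 0 + z * e 0 0) (fun z => v1 1 0 + z * e 1 0) 0).
- exact: segment_connected.
- by apply: (@within_comp _ _ _ _ setT g f) => //; exact: continuous_subspaceT.
- exact: cm.
- exact: ce.
- exact: ce.
- move=> z /itv hz.
  have := over_shift (w := v1 + z *: e) (ow z hz); rewrite overE !mxE; apply.
  move=> k; rewrite (_ : _ - _ = v1 k 0 - w k 0); first exact: wv.
  by rewrite !mxE; ring.
- by move=> z /itv hz; have := om z hz; rewrite overE !mxE.
- by move=> z /itv hz; apply: fr; exact: rg.
- by rewrite /= in_itv /=.
- exact: f0.
Qed.

Lemma Veech_conjugate s' t' (A : 'M[int]_2) (h : surface R s' t' -> X) h' :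
  homeo h h' -> unfolds A h -> Veech R s t A ->
  exists w : 'S_n, (s' = w * s * w^-1 /\ t' = w * t * w^-1)%g.
Proof.
move=> hh hA [f [d [g [[fK gK] [cf cg] fz df dg]]]].
have [hK h'K ch ch'] := hh.
have hI : injective h := can_inj hK.
have fr x : ~ zeros x -> ~ zeros (f x).
  move=> xr xz; have : (f @` @zeros R n s t) (f x) by rewrite fz.
  by move=> [y yz /(can_inj fK) yx]; apply: xr; rewrite -yx.
have gr x : ~ zeros x -> ~ zeros (g x).
  by move=> xr xz; apply: xr; rewrite -(gK x) -fz; exists (g x).
have hr x : ~ zeros x -> ~ zeros (h x).
  by move=> xr /(proj1 (unfolds_zeros hI hA x)).
pose AR : 'M[R]_2 := map_mx intr A.
have IA (v : 'cV[R]_2) : map_mx intr (invmx A) *m (AR *m v) = v.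
  by rewrite mulmxA -map_mxM mulVmx ?unitmxE ?d ?unitr1// map_mx1 mul1mx.
have overh x v : Defs.over x v -> Defs.over (h x) (AR *m v).
  by rewrite !overE => /hA.1; rewrite !mulmx2E !mxE.
have half : (0 : R) <= (2^-1 : R) <= (1 : R) by lra.
have half01 : ~ ((2^-1 : R) \is a Num.int) := @half_not_int R.
pose ctr (j : 'I_n) := ptc s' t' j (2^-1 : R) 2^-1.
(* [g] has derivative the inverse of A, so [g \o h] preserves displacements along regular paths. *)
pose y (j : 'I_n) := g (h (ctr j)).
have yr j : ~ zeros (y j).
  apply/gr/hr; apply: (ov_regular (ov_ptc s' t' j half half)) => -[] //.
have [w wP] : exists w : 'I_n -> 'I_n, forall j, labelled (y j) (w j).
  by have [w wP] := @boolp.choice _ _ (fun j i => labelled (y j) i) (fun j => labelled_exists (y j)); exists w.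
have wpath (k : R -> surface R s' t') (m : R -> X) (e : 'cV[R]_2) j j' u v :
    {within `[0, 1], continuous k} -> {within `[0, 1], continuous m} ->
    (forall z, 0 <= z <= 1 -> Defs.over (k z) (vec 2^-1 2^-1 + z *: e)) ->
    (forall z, 0 <= z <= 1 -> ~ zeros (k z)) ->
    (forall z, 0 <= z <= 1 -> Defs.over (m z) (vec u v + z *: e)) ->
    k 0 = ctr j -> k 1 = ctr j' -> y j = m 0 -> y j' = m 1.
  move=> ck cm ok rk om k0 k1 yj.
  rewrite /y -k1; apply: (@transport_path g (invmx A) (h \o k) m (AR *m vec 2^-1 2^-1) (AR *m e) (vec u v) e).
  - exact: cg.
  - exact: dg.
  - exact: gr.
  - by apply: (@within_comp _ _ _ _ setT k h) => //; exact: continuous_subspaceT.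
  - by move=> z hz /=; rewrite scalemxAr -mulmxDr; apply: overh; exact: ok.
  - by move=> z hz; apply: hr; exact: rk.
  - exact: IA.
  - exact: cm.
  - exact: om.
  - by rewrite /= k0.
have ws j : w (s' j) = s (w j).
  have [u [v [hu hv yE]]] := wP j.
  apply: (labelled_uniq (yr _) (wP _)); exists u, v; split=> //.
  (* Both lines start one square to the left: [u] may be 0, while [hline_cvg] asks for a positive
     abscissa. *)
  pose k z := hline s' t' (s'^-1%g j) (3 / 2 + z) (2^-1 : R).
  pose m z := hline s t (s^-1%g (w j)) (1 + u + z) v.
  rewrite (@wpath k m (vec 1 0) j (s' j) u v).
  - by rewrite /m (@hlineE _ _ _ _ _ 2) /= ?permKV; [congr ptc|]; lra.
  - apply/subspace_continuousP => z; rewrite /= in_itv /= => hz.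
    apply: hline_cvg; [lra| |exact: cvg_cst].
    by apply: cvg_within_filter; apply: cvgD; [exact: cvg_cst|exact: cvg_id].
  - apply/subspace_continuousP => z; rewrite /= in_itv /= => hz.
    apply: hline_cvg; [lra| |exact: cvg_cst].
    by apply: cvg_within_filter; apply: cvgD; [exact: cvg_cst|exact: cvg_id].
  - move=> z hz; rewrite overE !mxE /=.
    apply: (ov_shift (hline_ov _ _ _ _ half)); first by lra.
      by rewrite (_ : _ - _ = -1) ?rpredN1//; lra.
    by rewrite (_ : _ - _ = 0) ?rpred0//; lra.
  - move=> z hz; apply: (ov_regular (hline_ov s' t' (s'^-1%g j) _ half)); first by lra.
    by move=> [_ /half01].
  - move=> z hz; rewrite overE !mxE /=.
    apply: (ov_shift (hline_ov _ _ _ _ _)); [lra|lra| |].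
      by rewrite (_ : _ - _ = -1) ?rpredN1//; lra.
    by rewrite (_ : _ - _ = 0) ?rpred0//; lra.
  - by rewrite /k (@hlineE _ _ _ _ _ 1) /= ?permKV /ctr; [congr ptc|]; lra.
  - by rewrite /k (@hlineE _ _ _ _ _ 2) /= ?permKV /ctr; [congr ptc|]; lra.
  - by rewrite /m (@hlineE _ _ _ _ _ 1) /= ?permKV ?yE; [congr ptc|]; lra.
have wt j : w (t' j) = t (w j).
  have [u [v [hu hv yE]]] := wP j.
  apply: (labelled_uniq (yr _) (wP _)); exists u, v; split=> //.
  have [V' [cV' oV' V'E]] := vline_exists R s' t' (t'^-1%g j).
  have [V [cV oV VE]] := vline_exists R s t (t^-1%g (w j)).
  have hu' : 0 <= u <= 1 by lra.
  pose k z := V' (2^-1 : R) (3 / 2 + z).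
  pose m z := V u (1 + v + z).
  rewrite (@wpath k m (vec 0 1) j (t' j) u v).
  - by rewrite /m (VE 2%N) /= ?permKV; [congr ptc|..]; lra.
  - apply/subspace_continuousP => z; rewrite /= in_itv /= => hz.
    apply: cV'; [lra|exact: cvg_cst|].
    by apply: cvg_within_filter; apply: cvgD; [exact: cvg_cst|exact: cvg_id].
  - apply/subspace_continuousP => z; rewrite /= in_itv /= => hz.
    apply: cV; [lra|exact: cvg_cst|].
    by apply: cvg_within_filter; apply: cvgD; [exact: cvg_cst|exact: cvg_id].
  - move=> z hz; rewrite overE !mxE /=.
    apply: (ov_shift (oV' _ _ half _)); first by lra.
      by rewrite (_ : _ - _ = 0) ?rpred0//; lra.
    by rewrite (_ : _ - _ = -1) ?rpredN1//; lra.
  - move=> z hz; apply: (ov_regular (oV' _ _ half _)); first by lra.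
    by move=> [/half01].
  - move=> z hz; rewrite overE !mxE /=.
    apply: (ov_shift (oV _ _ hu' _)); first by lra.
      by rewrite (_ : _ - _ = 0) ?rpred0//; lra.
    by rewrite (_ : _ - _ = -1) ?rpredN1//; lra.
  - by rewrite /k (V'E 1%N) /= ?permKV /ctr; [congr ptc|..]; lra.
  - by rewrite /k (V'E 2%N) /= ?permKV /ctr; [congr ptc|..]; lra.
  - by rewrite /m (VE 1%N) /= ?permKV ?yE; [congr ptc|..]; lra.
have wI : injective w.
  move=> j j' wj.
  have [u [v [hu hv yE]]] := wP j.
  have [u' [v' [hu' hv' yE']]] := wP j'; rewrite -wj in yE'.
  pose e : 'cV[R]_2 := vec (u' - u) (v' - v).
  pose k (z : R) := ptc s t (w j) (u + z * (u' - u)) (v + z * (v' - v)).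
  have kin (z : R) : 0 <= z <= 1 -> 0 <= u + z * (u' - u) < 1 /\ 0 <= v + z * (v' - v) < 1.
    by move=> hz; split; apply: (unit_convex _ _ hz).1.
  have k0 : k 0 = y j by rewrite yE /k !mul0r !addr0.
  have k1 : k 1 = y j' by rewrite yE' /k !mul1r; congr ptc; ring.
  have ok z : 0 <= z <= 1 -> Defs.over (k z) (vec u v + z *: e).
    by move=> hz; have [h1 h2] := kin z hz; rewrite overE !mxE /=; apply: ov_ptc; lra.
  have ck : {within `[0, 1], continuous k}.
    apply: continuous_subspaceT => z.
    by apply: ptc_cvg; (apply: cvgD; [exact: cvg_cst|apply: cvgMl; exact: cvg_id]).
  (* Inside a half-open square the only corner is the south-west one. Reaching it before the end
     means having started there, and both end points are regular. *)
  have rk z : 0 <= z <= 1 -> ~ zeros (k z).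
    move=> hz; have [h1 h2] := kin z hz.
    have [[ia ib]|] := pselect (u + z * (u' - u) \is a Num.int /\ v + z * (v' - v) \is a Num.int); last first.
      by apply: ov_regular; apply: ov_ptc; lra.
    have a0 : u + z * (u' - u) = 0.
      by apply: int_eq; rewrite subr0// ltr_norml; lra.
    have b0 : v + z * (v' - v) = 0.
      by apply: int_eq; rewrite subr0// ltr_norml; lra.
    have [z1|z1] := eqVneq z 1; first by rewrite z1 k1.
    have zlt1 : z < 1 by rewrite lt_neqAle z1; case/andP: hz.
    have u0 := (unit_convex hu hu' hz).2 a0 zlt1.
    have v0 := (unit_convex hv hv' hz).2 b0 zlt1.
    have -> : k z = y j by rewrite yE /k a0 b0 u0 v0.
    exact: yr.
  have [w0 ow] := transport cf df ck ok rk.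
  have oc i : Defs.over (h (ctr i)) (AR *m vec 2^-1 2^-1).
    by apply: overh; exact: ov_ptc.
  have z0 : (0 : R) <= (0 : R) <= (1 : R) by lra.
  have z1 : (0 : R) <= (1 : R) <= (1 : R) by lra.
  have H0 := ow 0 z0; rewrite k0 gK scale0r addr0 in H0.
  have H1 := ow 1 z1; rewrite k1 gK scale1r in H1.
  (* The images under [f] of the two ends of the segment are images under [h] of centres, hence lie
     over the same torus point. *)
  have Ie i : (AR *m e) i 0 \is a Num.int.
    have a0 := over_uniq (oc j) H0 i; have a1 := over_uniq (oc j') H1 i.
    rewrite (_ : (AR *m e) i 0 = ((AR *m vec 2^-1 2^-1) i 0 - w0 i 0) -
      ((AR *m vec 2^-1 2^-1) i 0 - (w0 + AR *m e) i 0)); first exact: rpredB.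
    by rewrite [(w0 + _) i 0]mxE; ring.
  have ei i : e i 0 \is a Num.int.
    rewrite -(IA e) mulmx2E rpredD// rpredM// mxE; exact: intr_int.
  have e0 : u' = u.
    by apply: int_eq; [have := ei 0; rewrite mxE|rewrite ltr_norml; lra].
  have e1 : v' = v.
    by apply: int_eq; [have := ei 1; rewrite mxE|rewrite ltr_norml; lra].
  have : y j = y j' by rewrite yE yE' e0 e1.
  move=> /(can_inj gK)/hI; apply: ptc_inj => //.
  by move=> [/half01].
have P j : perm wI j = w j by rewrite permE.
by exists (perm wI); split; apply/permP => j; rewrite !permM P -?ws -?wt -P permK.
Qed.

End AffineDiffeos.

Theorem theorem6p1p1 (R : realType) (n : nat) (hn : (1 <= n)%N)
    (sigma tau : 'S_n) (A : 'M[int]_2) (hA : SL2plus A) :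
  Veech_plus R sigma tau A <->
  conjugate_pairs (codeL_mx R sigma tau A) (codeL_mx R sigma tau (1%:M)%R).
Proof.
have [s' [t' [h [h' [hh hu]]]]] := unfolds_exists R sigma tau hA.
rewrite (codeL_mx_unfolds hA hh hu).
rewrite (codeL_mx_unfolds SL2plus1 (id_homeo _) (id_unfolds R sigma tau)).
split=> [[VA _]|[w /= [es et]]].
  have [w [es et]] := Veech_conjugate hh hu VA.
  (* [Veech_conjugate] writes the pair of X(s', t') as a conjugate of the pair of X, which is the
     reverse of the direction wanted here. *)
  exists w^-1%g; rewrite /= es et; split; first by rewrite invgK !mulgA mulVg mul1g mulgKV.
  by rewrite !invMg !invgK !mulgA !(mulVg, mul1g, mulgKV, mulgK).
split=> //; apply: (conjugate_Veech hA hh hu es).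
(* The codes only give a relation for [sigma^-1 * tau * sigma]; [tau] is recovered from it with the
   relation for [sigma]. *)
have -> : tau = (sigma * (sigma^-1 * tau * sigma) * sigma^-1)%g by rewrite !mulgA mulgV mul1g mulgK.
by rewrite et es !invMg !invgK !mulgA !(mulVg, mul1g, mulgKV, mulgK, mulgV).
Qed.
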